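(* The only tight quadratic operads generated by a single binary operation are the free operad $\mathbb F(E)$, the operad $\mathcal{L}ie$ for Lie algebras, and the operad $\mathcal{L}ie\,\mathcal{A}dm$ for Lie-admissible algebras. (Here $E$ denotes the generating collection, concentrated in arity $2$, with $E(2)$ generated as a $\Sigma_2$-module by the single binary operation, which may be symmetric, antisymmetric, or without symmetry.)
   Context: $\Bbbk$ is a field of characteristic $0$. Operads are unital $\Bbbk$-linear operads $\mathcal P=\{\mathcal P(n)\}_{n\ge1}$ ($\mathcal P(0)=0$) in graded vector spaces, with partial compositions $\circ_i$, unit $e\in\mathcal P(1)$ and right $\Sigma_n$-actions; in endomorphism operads $(f\cdot\sigma)(x_1,\dots,x_n)=\pm f(x_{\sigma^{-1}(1)},\dots,x_{\sigma^{-1}(n)})$. $\mathbb F(E)$ is the free operad on the collection $E$, $(R)$ the operadic ideal generated by $R$. Multiindices: $\mathbb Z^n$ is ordered componentwise ($\preceq$), $\wedge$ is the componentwise minimum, $\vec p\cdot\sigma=(p_{\sigma(1)},\dots,p_{\sigma(n)})$. For $\vec a\in\mathbb Z^m$, $\vec b\in\mathbb Z^n$: $\vec a\circ_i\vec b:=(a_1,\dots,a_{i-1},b_1+a_i,\dots,b_n+a_i,a_{i+1},\dots,a_m)$ and $[\vec a,\vec b]_{ij}:=(b_1+a_i,\dots,b_{j-1}+a_i,\;a_1+b_j,\dots,a_{i-1}+b_j,\;a_i+b_j-1,\;b_{j+1}+a_i,\dots,b_n+a_i,\;a_{i+1}+b_j,\dots,a_m+b_j)$. A multifiltration $F\mathcal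 P$ of $\mathcal P$ is a family of graded subspaces $F_{\vec p}\mathcal P(n)\subset\mathcal P(n)$, $n\ge1$, $\vec p\in\mathbb Z^n$, such that: $F_{\vec p'}\mathcal P(n)\subseteq F_{\vec p''}\mathcal P(n)$ if $\vec p'\preceq\vec p''$; $F_{\vec p}\mathcal P(n)\cdot\sigma=F_{\vec p\cdot\sigma}\mathcal P(n)$; $F_{\vec a}\mathcal P(m)\circ_iF_{\vec b}\mathcal P(n)\subseteq F_{\vec a\circ_i\vec b}\mathcal P(m+n-1)$; $e\in F_{(0)}\mathcal P(1)$. It is saturated if $F_{\vec p'}\mathcal P(n)\cap F_{\vec p''}\mathcal P(n)=F_{\vec p'\wedge\vec p''}\mathcal P(n)$ always. Operadic commutators: for $a\in\mathcal P(m)$, $b\in\mathcal P(n)$, $1\le i\le m$, $1\le j\le n$, $[a,b]_{ij}:=(a\circ_ib)\cdot(\tau_{i-1,j-1}\times\mathrm{id}_{m+n-i-j+1})-(-1)^{|a||b|}(b\circ_ja)\cdot(\mathrm{id}_{i+j-1}\times\tau_{m-i,n-j})$, where $\tau_{r,s}\in\Sigma_{r+s}$ is the block transposition $\tau_{r,s}(k)=k+r$ for $k\le s$, $\tau_{r,s}(k)=k-s$ for $k>s$. A multifiltration is a D-multifiltration if $[F_{\vec p}\mathcal P(m),F_{\vec q}\mathcal P(n)]_{ij}\subseteq F_{[\vec p,\vec q]_{ij}}\mathcal P(m+n-1)$ for all $\vec p,\vec q,i,j$. For an operad generated by a collection $E$, the standard D-multifiltration $\overline G\mathcal P$ with respect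 to $E$ is the smallest (componentwise) saturated D-multifiltration with $E(n)\subset \overline G_{(1,\dots,1)}\mathcal P(n)$ for all $n\ge1$. An operad $\mathcal P$ with generating collection $E$ is tight if it has a presentation $\mathcal P=\mathbb F(E)/(R)$ with $R(n)\subset\overline G_{(1,\dots,1)}\mathbb F(E)(n)$ for each $n\ge1$, where $\overline G\mathbb F(E)$ is the standard D-multifiltration of $\mathbb F(E)$ with respect to $E$. It is quadratic if it is presented as $\mathbb F(E)/(R)$ with $R$ in the span of composites of two generators (so $R\subset\mathbb F(E)(3)$ for binary generators). $\mathcal{L}ie$: one antisymmetric binary generator $[-,-]$ modulo the Jacobi identity $[1,[2,3]]+[2,[3,1]]+[3,[1,2]]=0$. $\mathcal{L}ie\,\mathcal{A}dm$: one binary generator $(-,-)$ without symmetry modulo $\sum_{\sigma\in\Sigma_3}\mathrm{sgn}(\sigma)\,\mathrm{Ass}(\sigma(1),\sigma(2),\sigma(3))=0$, where $\mathrm{Ass}(1,2,3)=((1,2),3)-(1,(2,3))$. *)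

(* Defs.v *)
From HB Require Import structures.
From mathcomp Require Import all_boot all_order all_fingroup all_algebra.
From mathcomp Require Import boolp classical_sets.
From mathcomp Require Import zify.

Set Implicit Arguments.
Unset Strict Implicit.
Unset Printing Implicit Defensive.

Import Order.TTheory GRing.Theory Num.Theory.
Local Open Scope classical_set_scope.
Local Open Scope ring_scope.

(* CONVENTIONS.
   - Operads have no arity-0 part, so the index n stands for arity n.+1
     throughout, and composing arities m.+1 and n.+1 lands at index m + n.
     Inputs are numbered from 0, by 'I_n.+1.
   - A graded vector space is a family of modules indexed by degrees d : int;
     all elements are thereby homogeneous.
   - Compositions carry proofs of m + n = r and c + d = q, so that equations
     between differently bracketed composites need no transports.
   - Permutations compose as functions; MathComp composes them from left to
     right, so "sigma after tau" is (tau * sigma)%g. *)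

(* The permutation of 'I_n.+1 with the values of f, if there is one. *)
Definition nat_perm n (f : nat -> nat) : 'S_n.+1 :=
  odflt 1%g [pick s : 'S_n.+1 | [forall i, (s i == f i :> nat)]].

Lemma nat_permE n (f : nat -> nat) :
  (forall i, (i <= n)%N -> (f i <= n)%N) ->
  (forall i j, (i <= n)%N -> (j <= n)%N -> f i = f j -> i = j) ->
  forall i : 'I_n.+1, nat_perm n f i = f i :> nat.
Proof.
move=> fn finj i.
have le (x : 'I_n.+1) : (x <= n)%N by rewrite -ltnS.
have inj : injective (fun i : 'I_n.+1 => inord (f i) : 'I_n.+1).
  move=> x y /(congr1 val) /=.
  by rewrite !inordK ?ltnS ?fn // => /finj h; apply/val_inj/h.
rewrite /nat_perm; case: pickP => [s /forallP /(_ i) /eqP //|/(_ (perm inj))].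
by case/forallP => j; rewrite permE inordK // ltnS fn.
Qed.

(* id_o x tau_(u,v) x id, with tau_(u,v) k = k + u for k < v and k - v for
   v <= k < u + v. *)
Definition block_swap (o u v k : nat) : nat :=
  if (k < o)%N then k
  else if (k < o + v)%N then (k + u)%N
  else if (k < o + v + u)%N then (k - v)%N
  else k.

Lemma block_swapE n o u v : (o + v + u <= n.+1)%N ->
  forall i : 'I_n.+1, nat_perm n (block_swap o u v) i = block_swap o u v i :> nat.
Proof.
move=> le; apply: nat_permE; rewrite /block_swap.
- by move=> i; do !case: ifP; lia.
- by move=> i j; do !case: ifP; lia.
Qed.

(* sigma o_i tau, the permutation such that
   (a sigma) o_i (b tau) = (a o_(sigma i) b) (sigma o_i tau). *)
Definition perm_comp_fun m n (sigma : 'S_m.+1) (i : 'I_m.+1) (tau : 'S_n.+1)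
    (k : nat) : nat :=
  let outer (u : nat) := if (u < sigma i)%N then u else (u + n)%N in
  if (k < i)%N then outer (sigma (inord k))
  else if (k <= i + n)%N then (sigma i + tau (inord (k - i)))%N
  else outer (sigma (inord (k - n))).

Definition perm_comp m n r (sigma : 'S_m.+1) (i : 'I_m.+1) (tau : 'S_n.+1) :
    'S_r.+1 :=
  nat_perm r (perm_comp_fun sigma i tau).

Lemma perm_compE m n r (e : (m + n)%N = r) sigma i tau (k : 'I_r.+1) :
  @perm_comp m n r sigma i tau k = @perm_comp_fun m n sigma i tau k :> nat.
Proof.
have le p (x : 'I_p.+1) : (x <= p)%N by rewrite -ltnS.
have im := le _ i; have sm := le _ (sigma i).
pose out (u : nat) := if (u < sigma i)%N then u else (u + n)%N.
have part (u : nat) : (u <= r)%N ->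
    (exists x : 'I_m.+1, [/\ x <> i, perm_comp_fun sigma i tau u = out (sigma x)
      & u = if (x < i)%N then x : nat else (x + n)%N]) \/
    (exists x : 'I_n.+1, perm_comp_fun sigma i tau u = (sigma i + tau x)%N
      /\ u = (i + x)%N).
  move=> ur; rewrite /perm_comp_fun; case: (ltnP u i) => ui.
    have u_m : (u < m.+1)%N by lia.
    left; exists (inord u); split=> //; last by rewrite inordK // ui.
    by move=> /(congr1 val); rewrite /= inordK //; lia.
  case: (leqP u (i + n)) => uin.
    by right; exists (inord (u - i)); split=> //; rewrite inordK; lia.
  have u_m : (u - n < m.+1)%N by lia.
  left; exists (inord (u - n)); split=> //.
    by move=> /(congr1 val); rewrite /= inordK //; lia.
  by rewrite inordK //; case: ifP; lia.
have neq (x : 'I_m.+1) : x <> i -> sigma x <> sigma i :> nat.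
  by move=> xi /val_inj /perm_inj.
apply: nat_permE.
- move=> u /part [] [x].
    case=> _ -> _; rewrite /out; have := le _ (sigma x); case: ifP; lia.
  by case=> -> _; have := le _ (tau x); lia.
- move=> u v /part [] [x] hx /part [] [y] hy.
  + case: hx => /neq nx -> ->; case: hy => /neq ny -> -> eq.
    suff -> : x = y by [].
    apply: (@perm_inj _ sigma); apply: val_inj => /=.
    by move: eq nx ny; rewrite /out; do !case: ifP; lia.
  + case: hx => /neq nx -> _; case: hy => -> _ eq; have := le _ (tau y).
    by move: eq nx; rewrite /out; case: ifP; lia.
  + case: hy => /neq ny -> _; case: hx => -> _ eq; have := le _ (tau x).
    by move: eq ny; rewrite /out; case: ifP; lia.
  + case: hx => -> ->; case: hy => -> -> /addnI /val_inj /perm_inj ->.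
    by [].
Qed.

Definition is_subspace (k : fieldType) (V : lmodType k) (A : set V) : Prop :=
  A 0 /\ forall (c : k) x y, A x -> A y -> A (c *: x + y).

Definition lin_span (k : fieldType) (V : lmodType k) (A : set V) : set V :=
  smallest (@is_subspace k V) A.

Record collection (k : fieldType) := Collection {
  col_car :> nat -> int -> lmodType k;
  act : forall n d, 'S_n.+1 -> col_car n d -> col_car n d;
  act_linear : forall n d (s : 'S_n.+1) (c : k) (x y : col_car n d),
    act s (c *: x + y) = c *: act s x + act s y;
  act_id : forall n d (x : col_car n d), act 1%g x = x;
  act_act : forall n d (s t : 'S_n.+1) (x : col_car n d),
    act t (act s x) = act (t * s)%g x
}.
Arguments act {k c n d} _ _ : rename.

Record operad (k : fieldType) := Operad {
  op_col :> collection k;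
  op_unit : op_col 0%N 0;
  comp : forall m n r (e : (m + n)%N = r) c d q (f : c + d = q),
    'I_m.+1 -> op_col m c -> op_col n d -> op_col r q;
  comp_linear_l : forall m n r (e : (m + n)%N = r) c d q (f : c + d = q)
      (i : 'I_m.+1) (z : k) (a a' : op_col m c) (b : op_col n d),
    comp e f i (z *: a + a') b = z *: comp e f i a b + comp e f i a' b;
  comp_linear_r : forall m n r (e : (m + n)%N = r) c d q (f : c + d = q)
      (i : 'I_m.+1) (z : k) (a : op_col m c) (b b' : op_col n d),
    comp e f i a (z *: b + b') = z *: comp e f i a b + comp e f i a b';
  comp_unit_l : forall n (e : (0 + n)%N = n) d (f : 0 + d = d) (i : 'I_1)
      (a : op_col n d),
    comp e f i op_unit a = a;
  comp_unit_r : forall n (e : (n + 0)%N = n) d (f : d + 0 = d) (i : 'I_n.+1)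
      (a : op_col n d),
    comp e f i a op_unit = a;
  comp_seq : forall l m n r s t (e1 : (l + m)%N = r) (e2 : (r + n)%N = t)
      (e3 : (m + n)%N = s) (e4 : (l + s)%N = t)
      b c d p q o (f1 : b + c = p) (f2 : p + d = o) (f3 : c + d = q)
      (f4 : b + q = o)
      (i : 'I_l.+1) (j : 'I_m.+1) (u : 'I_r.+1)
      (x : op_col l b) (y : op_col m c) (z : op_col n d),
    u = (i + j)%N :> nat ->
    comp e2 f2 u (comp e1 f1 i x y) z = comp e4 f4 i x (comp e3 f3 j y z);
  comp_par : forall l m n r s t (e1 : (l + m)%N = r) (e2 : (r + n)%N = t)
      (e3 : (l + n)%N = s) (e4 : (s + m)%N = t)
      b c d p q o (f1 : b + c = p) (f2 : p + d = o) (f3 : b + d = q)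
      (f4 : q + c = o)
      (i j : 'I_l.+1) (u : 'I_r.+1) (v : 'I_s.+1)
      (x : op_col l b) (y : op_col m c) (z : op_col n d),
    (i < j)%N -> u = (j + m)%N :> nat -> v = i :> nat ->
    comp e2 f2 u (comp e1 f1 i x y) z =
      (-1) ^ (c * d) *: comp e4 f4 v (comp e3 f3 j x z) y;
  comp_act : forall m n r (e : (m + n)%N = r) c d q (f : c + d = q)
      (i : 'I_m.+1) (s : 'S_m.+1) (t : 'S_n.+1)
      (a : op_col m c) (b : op_col n d),
    comp e f i (act s a) (act t b) =
      act (perm_comp r s i t) (comp e f (s i) a b)
}.
Arguments op_unit {k} _.
Arguments comp {k o m n r} e {c d q} f _ _ _ : rename.

Record col_hom (k : fieldType) (E F : collection k) := ColHom {
  col_fun :> forall n d, E n d -> F n d;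
  col_hom_linear : forall n d (c : k) (x y : E n d),
    col_fun (c *: x + y) = c *: col_fun x + col_fun y;
  col_hom_act : forall n d (s : 'S_n.+1) (x : E n d),
    col_fun (act s x) = act s (col_fun x)
}.
Arguments col_fun {k E F} _ {n d} _.

Section ColHomTheory.
Variables (k : fieldType) (E F : collection k) (h : col_hom E F).

Lemma col_homD n d (x y : E n d) : h n d (x + y) = h n d x + h n d y.
Proof. by rewrite -[x]scale1r col_hom_linear !scale1r. Qed.

Lemma col_hom0 n d : h n d 0 = 0.
Proof. by apply: (addrI (h n d 0)); rewrite -col_homD !addr0. Qed.

Lemma col_homZ n d (c : k) (x : E n d) : h n d (c *: x) = c *: h n d x.
Proof. by rewrite -[c *: x]addr0 col_hom_linear col_hom0 addr0. Qed.

End ColHomTheory.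

Record op_hom (k : fieldType) (P Q : operad k) := OpHom {
  op_fun :> col_hom P Q;
  op_hom_unit : op_fun _ _ (op_unit P) = op_unit Q;
  op_hom_comp : forall m n r (e : (m + n)%N = r) c d q (f : c + d = q)
      (i : 'I_m.+1) (a : P m c) (b : P n d),
    op_fun _ _ (comp e f i a b) = comp e f i (op_fun _ _ a) (op_fun _ _ b)
}.

Definition op_bijective (k : fieldType) (P Q : operad k) (f : op_hom P Q) :=
  forall n d, bijective (fun x : P n d => f n d x).

Definition op_iso (k : fieldType) (P Q : operad k) : Prop :=
  exists f : op_hom P Q, op_bijective f.

Record premodule (k : fieldType) := Premodule {
  pm_car :> Type;
  pm_eq : pm_car -> pm_car -> Prop;
  pm_zero : pm_car;
  pm_add : pm_car -> pm_car -> pm_car;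
  pm_scale : k -> pm_car -> pm_car;
  pm_refl : forall x, pm_eq x x;
  pm_sym : forall x y, pm_eq x y -> pm_eq y x;
  pm_trans : forall x y z, pm_eq x y -> pm_eq y z -> pm_eq x z;
  pm_add_congr : forall x x' y y',
    pm_eq x x' -> pm_eq y y' -> pm_eq (pm_add x y) (pm_add x' y');
  pm_scale_congr : forall c x x',
    pm_eq x x' -> pm_eq (pm_scale c x) (pm_scale c x');
  pm_addA : forall x y z, pm_eq (pm_add x (pm_add y z)) (pm_add (pm_add x y) z);
  pm_addC : forall x y, pm_eq (pm_add x y) (pm_add y x);
  pm_add0 : forall x, pm_eq (pm_add pm_zero x) x;
  pm_addN : forall x, pm_eq (pm_add (pm_scale (-1) x) x) pm_zero;
  pm_scaleA : forall a b x,
    pm_eq (pm_scale a (pm_scale b x)) (pm_scale (a * b) x);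
  pm_scale1 : forall x, pm_eq (pm_scale 1 x) x;
  pm_scaleDr : forall a x y,
    pm_eq (pm_scale a (pm_add x y)) (pm_add (pm_scale a x) (pm_scale a y));
  pm_scaleDl : forall a b x,
    pm_eq (pm_scale (a + b) x) (pm_add (pm_scale a x) (pm_scale b x))
}.
Arguments pm_eq {k p} _ _ : rename.
Arguments pm_zero {k p} : rename.
Arguments pm_add {k p} _ _ : rename.
Arguments pm_scale {k p} _ _ : rename.

Definition quotmod (k : fieldType) (V : premodule k) : Type :=
  {A : set V | exists x, A = pm_eq x}.

Section QuotientModule.
Variables (k : fieldType) (V : premodule k).

Definition to_quot (x : V) : quotmod V :=
  exist _ (pm_eq x : set V) (ex_intro _ x erefl).

Definition quot_repr (q : quotmod V) : V := projT1 (cid (projT2 q)).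

Lemma quot_reprK q : to_quot (quot_repr q) = q.
Proof.
rewrite /quot_repr; case: (cid _) => x /= qx.
by case: q qx => A ex /= Ax; apply: eq_exist.
Qed.

Lemma to_quot_eq x y : pm_eq x y -> to_quot x = to_quot y.
Proof.
move=> xy; apply: eq_exist; apply/funext => z; apply/propext; split.
- by apply: pm_trans; apply: pm_sym.
- exact: pm_trans.
Qed.

Lemma to_quot_inj x y : to_quot x = to_quot y -> pm_eq x y.
Proof.
move=> /(congr1 (fun q : quotmod V => sval q y)) /= ->; exact: pm_refl.
Qed.

Lemma quot_reprP x : pm_eq (quot_repr (to_quot x)) x.
Proof. by apply: to_quot_inj; rewrite quot_reprK. Qed.

Lemma quot_ind (Q : quotmod V -> Prop) :
  (forall x, Q (to_quot x)) -> forall q, Q q.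
Proof. by move=> h q; rewrite -(quot_reprK q). Qed.

HB.instance Definition _ := gen_eqMixin (quotmod V).
HB.instance Definition _ := gen_choiceMixin (quotmod V).

Definition quot_add (p q : quotmod V) :=
  to_quot (pm_add (quot_repr p) (quot_repr q)).
Definition quot_scale (c : k) (q : quotmod V) :=
  to_quot (pm_scale c (quot_repr q)).

Lemma quot_addE x y : quot_add (to_quot x) (to_quot y) = to_quot (pm_add x y).
Proof. by apply/to_quot_eq/pm_add_congr; apply: quot_reprP. Qed.

Lemma quot_scaleE c x : quot_scale c (to_quot x) = to_quot (pm_scale c x).
Proof. by apply/to_quot_eq/pm_scale_congr/quot_reprP. Qed.

Fact quot_addA : associative quot_add.
Proof.
elim/quot_ind=> x; elim/quot_ind=> y; elim/quot_ind=> z.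
by rewrite !quot_addE; apply/to_quot_eq/pm_addA.
Qed.

Fact quot_addC : commutative quot_add.
Proof.
elim/quot_ind=> x; elim/quot_ind=> y.
by rewrite !quot_addE; apply/to_quot_eq/pm_addC.
Qed.

Fact quot_add0 : left_id (to_quot pm_zero) quot_add.
Proof. by elim/quot_ind=> x; rewrite quot_addE; apply/to_quot_eq/pm_add0. Qed.

Fact quot_addN : left_inverse (to_quot pm_zero) (quot_scale (-1)) quot_add.
Proof.
by elim/quot_ind=> x; rewrite quot_scaleE quot_addE; apply/to_quot_eq/pm_addN.
Qed.

HB.instance Definition _ := GRing.isZmodule.Build (quotmod V)
  quot_addA quot_addC quot_add0 quot_addN.

Fact quot_scaleA a b q : quot_scale a (quot_scale b q) = quot_scale (a * b) q.
Proof.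
by elim/quot_ind: q => x; rewrite !quot_scaleE; apply/to_quot_eq/pm_scaleA.
Qed.

Fact quot_scale1 : left_id 1 quot_scale.
Proof.
by elim/quot_ind => x; rewrite quot_scaleE; apply/to_quot_eq/pm_scale1.
Qed.

Fact quot_scaleDr : right_distributive quot_scale +%R.
Proof.
move=> c; elim/quot_ind=> x; elim/quot_ind=> y.
rewrite -![_ + _]/(quot_add _ _) !(quot_addE, quot_scaleE).
exact/to_quot_eq/pm_scaleDr.
Qed.

Fact quot_scaleDl q : {morph quot_scale^~ q : a b / a + b}.
Proof.
elim/quot_ind: q => x a b; rewrite -![X in _ = X]/(quot_add _ _).
by rewrite !(quot_addE, quot_scaleE); apply/to_quot_eq/pm_scaleDl.
Qed.

HB.instance Definition _ := GRing.Zmodule_isLmodule.Build k (quotmod V)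
  quot_scaleA quot_scale1 quot_scaleDr quot_scaleDl.

Definition quot_lmod : lmodType k := GRing.Lmodule.clone k (quotmod V) _.

Lemma to_quotD x y :
  to_quot (pm_add x y) = (to_quot x : quot_lmod) + (to_quot y : quot_lmod).
Proof. by rewrite -quot_addE. Qed.

Lemma to_quotZ c x : to_quot (pm_scale c x) = c *: (to_quot x : quot_lmod).
Proof. by rewrite -quot_scaleE. Qed.

Lemma to_quot0 : to_quot pm_zero = 0 :> quot_lmod.
Proof. by []. Qed.

End QuotientModule.

Record preoperad (k : fieldType) := Preoperad {
  po_car :> nat -> int -> premodule k;
  po_act : forall n d, 'S_n.+1 -> po_car n d -> po_car n d;
  po_unit : po_car 0%N 0;
  po_comp : forall m n r (e : (m + n)%N = r) c d q (f : c + d = q),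
    'I_m.+1 -> po_car m c -> po_car n d -> po_car r q;
  po_act_congr : forall n d (s : 'S_n.+1) (x y : po_car n d),
    pm_eq x y -> pm_eq (po_act s x) (po_act s y);
  po_comp_congr : forall m n r (e : (m + n)%N = r) c d q (f : c + d = q)
      (i : 'I_m.+1) (a a' : po_car m c) (b b' : po_car n d),
    pm_eq a a' -> pm_eq b b' ->
    pm_eq (po_comp e f i a b) (po_comp e f i a' b');
  po_act_linear : forall n d (s : 'S_n.+1) (c : k) (x y : po_car n d),
    pm_eq (po_act s (pm_add (pm_scale c x) y))
          (pm_add (pm_scale c (po_act s x)) (po_act s y));
  po_act_id : forall n d (x : po_car n d), pm_eq (po_act 1%g x) x;
  po_act_act : forall n d (s t : 'S_n.+1) (x : po_car n d),
    pm_eq (po_act t (po_act s x)) (po_act (t * s)%g x);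
  po_comp_linear_l : forall m n r (e : (m + n)%N = r) c d q (f : c + d = q)
      (i : 'I_m.+1) (z : k) (a a' : po_car m c) (b : po_car n d),
    pm_eq (po_comp e f i (pm_add (pm_scale z a) a') b)
          (pm_add (pm_scale z (po_comp e f i a b)) (po_comp e f i a' b));
  po_comp_linear_r : forall m n r (e : (m + n)%N = r) c d q (f : c + d = q)
      (i : 'I_m.+1) (z : k) (a : po_car m c) (b b' : po_car n d),
    pm_eq (po_comp e f i a (pm_add (pm_scale z b) b'))
          (pm_add (pm_scale z (po_comp e f i a b)) (po_comp e f i a b'));
  po_comp_unit_l : forall n (e : (0 + n)%N = n) d (f : 0 + d = d) (i : 'I_1)
      (a : po_car n d),
    pm_eq (po_comp e f i po_unit a) a;
  po_comp_unit_r : forall n (e : (n + 0)%N = n) d (f : d + 0 = d) (i : 'I_n.+1)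
      (a : po_car n d),
    pm_eq (po_comp e f i a po_unit) a;
  po_comp_seq : forall l m n r s t (e1 : (l + m)%N = r) (e2 : (r + n)%N = t)
      (e3 : (m + n)%N = s) (e4 : (l + s)%N = t)
      b c d p q o (f1 : b + c = p) (f2 : p + d = o) (f3 : c + d = q)
      (f4 : b + q = o)
      (i : 'I_l.+1) (j : 'I_m.+1) (u : 'I_r.+1)
      (x : po_car l b) (y : po_car m c) (z : po_car n d),
    u = (i + j)%N :> nat ->
    pm_eq (po_comp e2 f2 u (po_comp e1 f1 i x y) z)
          (po_comp e4 f4 i x (po_comp e3 f3 j y z));
  po_comp_par : forall l m n r s t (e1 : (l + m)%N = r) (e2 : (r + n)%N = t)
      (e3 : (l + n)%N = s) (e4 : (s + m)%N = t)
      b c d p q o (f1 : b + c = p) (f2 : p + d = o) (f3 : b + d = q)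
      (f4 : q + c = o)
      (i j : 'I_l.+1) (u : 'I_r.+1) (v : 'I_s.+1)
      (x : po_car l b) (y : po_car m c) (z : po_car n d),
    (i < j)%N -> u = (j + m)%N :> nat -> v = i :> nat ->
    pm_eq (po_comp e2 f2 u (po_comp e1 f1 i x y) z)
          (pm_scale ((-1) ^ (c * d)) (po_comp e4 f4 v (po_comp e3 f3 j x z) y));
  po_comp_act : forall m n r (e : (m + n)%N = r) c d q (f : c + d = q)
      (i : 'I_m.+1) (s : 'S_m.+1) (t : 'S_n.+1)
      (a : po_car m c) (b : po_car n d),
    pm_eq (po_comp e f i (po_act s a) (po_act t b))
          (po_act (perm_comp r s i t) (po_comp e f (s i) a b))
}.
Arguments po_act {k p n d} _ _ : rename.
Arguments po_unit {k} _.
Arguments po_comp {k p m n r} e {c d q} f _ _ _ : rename.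

Section OperadOfPreoperad.
Variables (k : fieldType) (P : preoperad k).

Definition quot_act n d (s : 'S_n.+1) (x : quot_lmod (P n d)) :
    quot_lmod (P n d) :=
  to_quot (po_act s (quot_repr x)).
Definition quot_comp m n r (e : (m + n)%N = r) c d q (f : c + d = q)
    (i : 'I_m.+1) (a : quot_lmod (P m c)) (b : quot_lmod (P n d)) :
    quot_lmod (P r q) :=
  to_quot (po_comp e f i (quot_repr a) (quot_repr b)).

Let qactE n d s (x : P n d) : quot_act s (to_quot x) = to_quot (po_act s x).
Proof. by apply/to_quot_eq/po_act_congr/quot_reprP. Qed.

Let qcompE m n r (e : (m + n)%N = r) c d q (f : c + d = q) i
    (a : P m c) (b : P n d) :
  quot_comp e f i (to_quot a) (to_quot b) = to_quot (po_comp e f i a b).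
Proof. by apply/to_quot_eq/po_comp_congr; apply: quot_reprP. Qed.

Definition quot_collection : collection k.
Proof.
refine (@Collection k (fun n d => quot_lmod (P n d)) quot_act _ _ _).
- move=> n d s c; elim/quot_ind=> x; elim/quot_ind=> y /=.
  rewrite -to_quotZ -to_quotD !qactE -to_quotZ -to_quotD.
  exact/to_quot_eq/po_act_linear.
- by move=> n d; elim/quot_ind=> x; rewrite qactE; apply/to_quot_eq/po_act_id.
- move=> n d s t; elim/quot_ind=> x; rewrite !qactE.
  exact/to_quot_eq/po_act_act.
Defined.

Definition quot_operad : operad k.
Proof.
refine (@Operad k quot_collection (to_quot (po_unit P)) quot_comp
  _ _ _ _ _ _ _) => /=.
- move=> m n r e c d q f i z.
  elim/quot_ind=> a; elim/quot_ind=> a'; elim/quot_ind=> b.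
  rewrite /= -to_quotZ -to_quotD !qcompE -to_quotZ -to_quotD.
  exact/to_quot_eq/po_comp_linear_l.
- move=> m n r e c d q f i z.
  elim/quot_ind=> a; elim/quot_ind=> b; elim/quot_ind=> b'.
  rewrite /= -to_quotZ -to_quotD !qcompE -to_quotZ -to_quotD.
  exact/to_quot_eq/po_comp_linear_r.
- move=> n e d f i; elim/quot_ind=> a; rewrite qcompE.
  exact/to_quot_eq/po_comp_unit_l.
- move=> n e d f i; elim/quot_ind=> a; rewrite qcompE.
  exact/to_quot_eq/po_comp_unit_r.
- move=> l m n r s t e1 e2 e3 e4 b c d p q o f1 f2 f3 f4 i j u.
  elim/quot_ind=> x; elim/quot_ind=> y; elim/quot_ind=> z h.
  by rewrite !qcompE; apply/to_quot_eq/po_comp_seq.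
- move=> l m n r s t e1 e2 e3 e4 b c d p q o f1 f2 f3 f4 i j u v.
  elim/quot_ind=> x; elim/quot_ind=> y; elim/quot_ind=> z h1 h2 h3.
  by rewrite !qcompE -to_quotZ; apply/to_quot_eq/po_comp_par.
- move=> m n r e c d q f i s t; elim/quot_ind=> a; elim/quot_ind=> b.
  rewrite -[LHS]/(quot_comp e f i (quot_act s (to_quot a))
                                  (quot_act t (to_quot b))).
  rewrite -[RHS]/(quot_act (perm_comp r s i t)
                    (quot_comp e f (s i) (to_quot a) (to_quot b))).
  rewrite (qactE s a) (qactE t b) !qcompE qactE.
  exact/to_quot_eq/po_comp_act.
Defined.

Lemma act_quotE n d s (x : P n d) :
  act s (to_quot x : quot_operad n d) = to_quot (po_act s x).
Proof. exact: qactE. Qed.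

Lemma comp_quotE m n r (e : (m + n)%N = r) c d q (f : c + d = q) i
    (a : P m c) (b : P n d) :
  comp e f i (to_quot a : quot_operad m c) (to_quot b : quot_operad n d) =
  to_quot (po_comp e f i a b).
Proof. exact: qcompE. Qed.

End OperadOfPreoperad.

(* Formal operadic expressions in E, modulo the smallest congruence enforcing
   the operad axioms and making E -> F(E) a morphism of collections. *)
Inductive fterm (k : fieldType) (E : collection k) : nat -> int -> Type :=
| fzero n d : fterm E n d
| fadd n d : fterm E n d -> fterm E n d -> fterm E n d
| fscale n d : k -> fterm E n d -> fterm E n d
| fact n d : 'S_n.+1 -> fterm E n d -> fterm E n d
| funit : fterm E 0%N 0
| fcomp m n r (e : (m + n)%N = r) c d q (f : c + d = q) :
    'I_m.+1 -> fterm E m c -> fterm E n d -> fterm E r q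
| fgen n d : E n d -> fterm E n d.
Arguments fzero {k E n d}.
Arguments funit {k E}.

Inductive feq (k : fieldType) (E : collection k) :
    forall n d, fterm E n d -> fterm E n d -> Prop :=
| feq_refl n d (x : fterm E n d) : feq x x
| feq_sym n d (x y : fterm E n d) : feq x y -> feq y x
| feq_trans n d (x y z : fterm E n d) : feq x y -> feq y z -> feq x z
| feq_add n d (x x' y y' : fterm E n d) :
    feq x x' -> feq y y' -> feq (fadd x y) (fadd x' y')
| feq_scale n d c (x x' : fterm E n d) :
    feq x x' -> feq (fscale c x) (fscale c x')
| feq_act n d (s : 'S_n.+1) (x y : fterm E n d) :
    feq x y -> feq (fact s x) (fact s y)
| feq_comp m n r (e : (m + n)%N = r) c d q (f : c + d = q) (i : 'I_m.+1)
      (a a' : fterm E m c) (b b' : fterm E n d) :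
    feq a a' -> feq b b' -> feq (fcomp e f i a b) (fcomp e f i a' b')
| feq_addA n d (x y z : fterm E n d) :
    feq (fadd x (fadd y z)) (fadd (fadd x y) z)
| feq_addC n d (x y : fterm E n d) : feq (fadd x y) (fadd y x)
| feq_add0 n d (x : fterm E n d) : feq (fadd fzero x) x
| feq_addN n d (x : fterm E n d) : feq (fadd (fscale (-1) x) x) fzero
| feq_scaleA n d a b (x : fterm E n d) :
    feq (fscale a (fscale b x)) (fscale (a * b) x)
| feq_scale1 n d (x : fterm E n d) : feq (fscale 1 x) x
| feq_scaleDr n d a (x y : fterm E n d) :
    feq (fscale a (fadd x y)) (fadd (fscale a x) (fscale a y))
| feq_scaleDl n d a b (x : fterm E n d) :
    feq (fscale (a + b) x) (fadd (fscale a x) (fscale b x))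
| feq_act_linear n d (s : 'S_n.+1) c (x y : fterm E n d) :
    feq (fact s (fadd (fscale c x) y)) (fadd (fscale c (fact s x)) (fact s y))
| feq_act_id n d (x : fterm E n d) : feq (fact 1%g x) x
| feq_act_act n d (s t : 'S_n.+1) (x : fterm E n d) :
    feq (fact t (fact s x)) (fact (t * s)%g x)
| feq_comp_linear_l m n r (e : (m + n)%N = r) c d q (f : c + d = q)
      (i : 'I_m.+1) z (a a' : fterm E m c) (b : fterm E n d) :
    feq (fcomp e f i (fadd (fscale z a) a') b)
        (fadd (fscale z (fcomp e f i a b)) (fcomp e f i a' b))
| feq_comp_linear_r m n r (e : (m + n)%N = r) c d q (f : c + d = q)
      (i : 'I_m.+1) z (a : fterm E m c) (b b' : fterm E n d) :
    feq (fcomp e f i a (fadd (fscale z b) b'))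
        (fadd (fscale z (fcomp e f i a b)) (fcomp e f i a b'))
| feq_unit_l n (e : (0 + n)%N = n) d (f : 0 + d = d) (i : 'I_1)
      (a : fterm E n d) :
    feq (fcomp e f i funit a) a
| feq_unit_r n (e : (n + 0)%N = n) d (f : d + 0 = d) (i : 'I_n.+1)
      (a : fterm E n d) :
    feq (fcomp e f i a funit) a
| feq_seq l m n r s t (e1 : (l + m)%N = r) (e2 : (r + n)%N = t)
      (e3 : (m + n)%N = s) (e4 : (l + s)%N = t)
      b c d p q o (f1 : b + c = p) (f2 : p + d = o) (f3 : c + d = q)
      (f4 : b + q = o)
      (i : 'I_l.+1) (j : 'I_m.+1) (u : 'I_r.+1)
      (x : fterm E l b) (y : fterm E m c) (z : fterm E n d) :
    u = (i + j)%N :> nat ->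
    feq (fcomp e2 f2 u (fcomp e1 f1 i x y) z)
        (fcomp e4 f4 i x (fcomp e3 f3 j y z))
| feq_par l m n r s t (e1 : (l + m)%N = r) (e2 : (r + n)%N = t)
      (e3 : (l + n)%N = s) (e4 : (s + m)%N = t)
      b c d p q o (f1 : b + c = p) (f2 : p + d = o) (f3 : b + d = q)
      (f4 : q + c = o)
      (i j : 'I_l.+1) (u : 'I_r.+1) (v : 'I_s.+1)
      (x : fterm E l b) (y : fterm E m c) (z : fterm E n d) :
    (i < j)%N -> u = (j + m)%N :> nat -> v = i :> nat ->
    feq (fcomp e2 f2 u (fcomp e1 f1 i x y) z)
        (fscale ((-1) ^ (c * d)) (fcomp e4 f4 v (fcomp e3 f3 j x z) y))
| feq_comp_act m n r (e : (m + n)%N = r) c d q (f : c + d = q)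
      (i : 'I_m.+1) (s : 'S_m.+1) (t : 'S_n.+1)
      (a : fterm E m c) (b : fterm E n d) :
    feq (fcomp e f i (fact s a) (fact t b))
        (fact (perm_comp r s i t) (fcomp e f (s i) a b))
| feq_gen_linear n d c (x y : E n d) :
    feq (fgen (c *: x + y)) (fadd (fscale c (fgen x)) (fgen y))
| feq_gen_act n d (s : 'S_n.+1) (x : E n d) :
    feq (fgen (act s x)) (fact s (fgen x)).

Section FreeOperad.
Variables (k : fieldType) (E : collection k).

Definition fterm_premodule n d : premodule k :=
  @Premodule k (fterm E n d) (@feq k E n d) fzero (@fadd k E n d)
    (@fscale k E n d)
    (@feq_refl k E n d) (@feq_sym k E n d) (@feq_trans k E n d)
    (@feq_add k E n d) (@feq_scale k E n d) (@feq_addA k E n d)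
    (@feq_addC k E n d) (@feq_add0 k E n d) (@feq_addN k E n d)
    (@feq_scaleA k E n d) (@feq_scale1 k E n d) (@feq_scaleDr k E n d)
    (@feq_scaleDl k E n d).

Definition fterm_preoperad : preoperad k :=
  @Preoperad k fterm_premodule (@fact k E) funit (@fcomp k E)
    (@feq_act k E) (@feq_comp k E) (@feq_act_linear k E) (@feq_act_id k E)
    (@feq_act_act k E) (@feq_comp_linear_l k E) (@feq_comp_linear_r k E)
    (@feq_unit_l k E) (@feq_unit_r k E) (@feq_seq k E) (@feq_par k E)
    (@feq_comp_act k E).

Definition free_operad : operad k := quot_operad fterm_preoperad.

Definition free_gen : col_hom E free_operad.
Proof.
refine (@ColHom k E free_operad
  (fun n d x => to_quot (fgen x : fterm_preoperad n d)) _ _).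
- move=> n d c x y; rewrite -to_quotZ -to_quotD.
  exact/to_quot_eq/feq_gen_linear.
- by move=> n d s x; rewrite act_quotE; apply/to_quot_eq/feq_gen_act.
Defined.

Section Lift.
Variables (P : operad k) (g : col_hom E P).

Fixpoint feval n d (x : fterm E n d) : P n d :=
  match x in fterm _ n d return P n d with
  | fzero _ _ => 0
  | fadd _ _ x y => feval x + feval y
  | fscale _ _ c x => c *: feval x
  | fact _ _ s x => act s (feval x)
  | funit => op_unit P
  | fcomp _ _ _ e _ _ _ f i a b => comp e f i (feval a) (feval b)
  | fgen _ _ x => g _ _ x
  end.

Lemma feval_eq n d (x y : fterm E n d) : feq x y -> feval x = feval y.
Proof.
elim=> {n d x y} //=.
- by move=> n d x y z _ -> _ ->.
- by move=> n d x x' y y' _ -> _ ->.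
- by move=> n d c x x' _ ->.
- by move=> n d s x y _ ->.
- by move=> m n r e c d q f i a a' b b' _ -> _ ->.
- by move=> *; rewrite addrA.
- by move=> *; rewrite addrC.
- by move=> *; rewrite add0r.
- by move=> *; rewrite scaleN1r addNr.
- by move=> *; rewrite scalerA.
- by move=> *; rewrite scale1r.
- by move=> *; rewrite scalerDr.
- by move=> *; rewrite scalerDl.
- by move=> *; rewrite act_linear.
- by move=> *; rewrite act_id.
- by move=> *; rewrite act_act.
- by move=> *; rewrite comp_linear_l.
- by move=> *; rewrite comp_linear_r.
- by move=> *; rewrite comp_unit_l.
- by move=> *; rewrite comp_unit_r.
- by move=> *; apply: comp_seq.
- by move=> *; apply: comp_par.
- by move=> *; apply: comp_act.
- by move=> *; apply: col_hom_linear.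
- by move=> *; apply: col_hom_act.
Qed.

Definition lift_fun n d (q : free_operad n d) : P n d := feval (quot_repr q).

Lemma lift_funE n d (x : fterm_preoperad n d) :
  lift_fun (to_quot x : free_operad n d) = feval x.
Proof. by apply: feval_eq; apply: (quot_reprP x). Qed.

Fact lift_linear n d (c : k) (x y : free_operad n d) :
  lift_fun (c *: x + y) = c *: lift_fun x + lift_fun y.
Proof.
elim/quot_ind: x => x; elim/quot_ind: y => y.
by rewrite -to_quotZ -to_quotD !lift_funE.
Qed.

Fact lift_act n d (s : 'S_n.+1) (x : free_operad n d) :
  lift_fun (act s x) = act s (lift_fun x).
Proof. by elim/quot_ind: x => x; rewrite act_quotE !lift_funE. Qed.

Fact lift_comp m n r (e : (m + n)%N = r) c d q (f : c + d = q) (i : 'I_m.+1)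
    (a : free_operad m c) (b : free_operad n d) :
  lift_fun (comp e f i a b) = comp e f i (lift_fun a) (lift_fun b).
Proof.
elim/quot_ind: a => a; elim/quot_ind: b => b.
apply: (etrans (congr1 (@lift_fun _ _)
  (comp_quotE (P := fterm_preoperad) e f i a b))).
by rewrite !lift_funE.
Qed.

Definition free_lift : op_hom free_operad P :=
  @OpHom k free_operad P (ColHom lift_linear lift_act)
    (lift_funE (funit : fterm_preoperad 0%N 0)) lift_comp.

Lemma free_lift_gen n d (x : E n d) : free_lift n d (free_gen n d x) = g n d x.
Proof. exact: (lift_funE (fgen x)). Qed.

End Lift.

Lemma free_hom_ext (P : operad k) (f f' : op_hom free_operad P) :
  (forall n d (x : E n d), f n d (free_gen n d x) = f' n d (free_gen n d x)) ->
  forall n d (x : free_operad n d), f n d x = f' n d x.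
Proof.
move=> ff' n d; elim/quot_ind=> x; elim: x => {n d}.
- by move=> n d; rewrite (to_quot0 (fterm_premodule n d)) !col_hom0.
- move=> n d x IHx y IHy.
  by rewrite (to_quotD (V := fterm_premodule n d)) !col_homD IHx IHy.
- move=> n d c x IHx.
  by rewrite (to_quotZ (V := fterm_premodule n d)) !col_homZ IHx.
- move=> n d s x IHx.
  by rewrite -(act_quotE (P := fterm_preoperad)) !col_hom_act IHx.
- by rewrite -[to_quot _]/(op_unit free_operad) !op_hom_unit.
- move=> m n r e c d q f0 i a IHa b IHb.
  by rewrite -(comp_quotE (P := fterm_preoperad)) !op_hom_comp IHa IHb.
- exact: ff'.
Qed.

End FreeOperad.

Definition subcollection (k : fieldType) (P : operad k) : Type :=
  forall n d, set (P n d).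

Record is_ideal (k : fieldType) (P : operad k) (I : subcollection P) : Prop :=
IsIdeal {
  ideal_subspace : forall n d, is_subspace (I n d);
  ideal_act : forall n d (s : 'S_n.+1) x, I n d x -> I n d (act s x);
  ideal_comp_l : forall m n r (e : (m + n)%N = r) c d q (f : c + d = q) i
      (a : P m c) (b : P n d),
    I m c a -> I r q (comp e f i a b);
  ideal_comp_r : forall m n r (e : (m + n)%N = r) c d q (f : c + d = q) i
      (a : P m c) (b : P n d),
    I n d b -> I r q (comp e f i a b)
}.

Definition ideal_gen (k : fieldType) (P : operad k) (R : subcollection P) :
    subcollection P :=
  fun n d => [set x | forall I : subcollection P, is_ideal I ->
    (forall n' d', R n' d' `<=` I n' d') -> I n d x].

Arguments ideal_gen {k P} R n d _.

Lemma ideal_gen_ideal (k : fieldType) (P : operad k) (R : subcollection P) :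
  is_ideal (ideal_gen R).
Proof.
split.
- move=> n d; split=> [|c x y hx hy] I hI RI.
    by case: (ideal_subspace hI n d).
  by have [_] := ideal_subspace hI n d; apply; [apply: hx|apply: hy].
- by move=> n d s x hx I hI RI; apply: ideal_act => //; apply: hx.
- move=> m n r e c d q f i a b h I hI RI.
  by apply: ideal_comp_l => //; apply: h.
- move=> m n r e c d q f i a b h I hI RI.
  by apply: ideal_comp_r => //; apply: h.
Qed.

Section SubspaceTheory.
Variables (k : fieldType) (V : lmodType k) (A : set V).
Hypothesis sA : is_subspace A.

Lemma subspace0 : A 0. Proof. by case: sA. Qed.
Lemma subspaceD x y : A x -> A y -> A (x + y).
Proof. by case: sA => _ h hx hy; rewrite -[x]scale1r; apply: h. Qed.
Lemma subspaceZ c x : A x -> A (c *: x).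
Proof. by case: sA => h0 h hx; rewrite -[_ *: _]addr0; apply: h. Qed.

End SubspaceTheory.

Section QuotientOperad.
Variables (k : fieldType) (P : operad k) (I : subcollection P).
Hypothesis hI : is_ideal I.
Local Arguments I _ _ _ : clear implicits.

Let eqI n d (x y : P n d) : Prop := I n d (x - y).

Let eqI_of_eq n d (x y : P n d) : x = y -> eqI x y.
Proof. by move=> ->; rewrite /eqI subrr; exact: (subspace0 (ideal_subspace hI n d)). Qed.

Let sI := ideal_subspace hI.

Definition coset_premodule (n : nat) (d : int) : premodule k.
Proof.
refine (@Premodule k (P n d) (@eqI n d) 0 +%R *:%R
  _ _ _ _ _ _ _ _ _ _ _ _ _).
- by move=> x; apply: eqI_of_eq.
- by move=> x y h; rewrite /eqI -opprB -scaleN1r; apply: (subspaceZ (sI n d)).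
- by move=> x y z h1 h2; rewrite /eqI -(subrKA y); apply: (subspaceD (sI n d)).
- by move=> x x' y y' h1 h2; rewrite /eqI opprD addrACA; apply: (subspaceD (sI n d)).
- by move=> c x x' h; rewrite /eqI -scalerBr; apply: (subspaceZ (sI n d)).
- by move=> x y z; apply: eqI_of_eq; rewrite addrA.
- by move=> x y; apply: eqI_of_eq; rewrite addrC.
- by move=> x; apply: eqI_of_eq; rewrite add0r.
- by move=> x; apply: eqI_of_eq; rewrite scaleN1r addNr.
- by move=> a b x; apply: eqI_of_eq; rewrite scalerA.
- by move=> x; apply: eqI_of_eq; rewrite scale1r.
- by move=> a x y; apply: eqI_of_eq; rewrite scalerDr.
- by move=> a b x; apply: eqI_of_eq; rewrite scalerDl.
Defined.

Definition coset_preoperad : preoperad k.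
Proof.
refine (@Preoperad k coset_premodule (@act k P) (op_unit P) (@comp k P)
  _ _ _ _ _ _ _ _ _ _ _ _).
- move=> n d s x y; rewrite /= /eqI => h.
  have -> : act s x - act s y = act s (x - y).
    by rewrite addrC -scaleN1r -act_linear scaleN1r addrC.
  exact: ideal_act.
- move=> m n r e c d q f i a a' b b'; rewrite /= /eqI => ha hb.
  rewrite -(subrKA (comp e f i a' b)); apply: subspaceD.
  + exact: ideal_subspace.
  + rewrite addrC -scaleN1r -comp_linear_l scaleN1r addrC.
    exact: ideal_comp_l.
  + rewrite addrC -scaleN1r -comp_linear_r scaleN1r addrC.
    exact: ideal_comp_r.
- by move=> *; apply: eqI_of_eq; apply: act_linear.
- by move=> *; apply: eqI_of_eq; apply: act_id.
- by move=> *; apply: eqI_of_eq; apply: act_act.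
- by move=> *; apply: eqI_of_eq; apply: comp_linear_l.
- by move=> *; apply: eqI_of_eq; apply: comp_linear_r.
- by move=> *; apply: eqI_of_eq; apply: comp_unit_l.
- by move=> *; apply: eqI_of_eq; apply: comp_unit_r.
- by move=> *; apply: eqI_of_eq; apply: comp_seq.
- by move=> *; apply: eqI_of_eq; apply: comp_par.
- by move=> *; apply: eqI_of_eq; apply: comp_act.
Defined.

Definition quotient_operad : operad k := quot_operad coset_preoperad.

Definition quotient_col_proj : col_hom P quotient_operad.
Proof.
refine (@ColHom k P quotient_operad
  (fun n d x => to_quot (x : coset_preoperad n d)) _ _).
- by move=> n d c x y; rewrite /= -to_quotZ -to_quotD.
- by move=> n d s x; rewrite act_quotE.
Defined.

Definition quotient_proj : op_hom P quotient_operad.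
Proof.
refine (@OpHom k P quotient_operad quotient_col_proj _ _) => //.
move=> m n r e c d q f i a b.
exact/esym/(comp_quotE (P := coset_preoperad)).
Defined.

Lemma quotient_projP n d (x y : P n d) :
  quotient_proj n d x = quotient_proj n d y <-> I n d (x - y).
Proof.
split; first exact: (@to_quot_inj _ (coset_preoperad n d)).
exact: (@to_quot_eq _ (coset_preoperad n d)).
Qed.

Lemma quotient_proj_surj n d (y : quotient_operad n d) :
  exists x, quotient_proj n d x = y.
Proof. by elim/quot_ind: y => x; exists x. Qed.

End QuotientOperad.

Definition presented_operad (k : fieldType) (E : collection k)
    (R : subcollection (free_operad E)) : operad k :=
  quotient_operad (ideal_gen_ideal R).

Definition presented_gen (k : fieldType) (E : collection k)
    (R : subcollection (free_operad E)) : col_hom E (presented_operad R).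
Proof.
refine (@ColHom k E (presented_operad R)
  (fun n d x => quotient_proj (ideal_gen_ideal R) n d (free_gen E n d x)) _ _).
- by move=> n d c x y; rewrite !col_hom_linear.
- by move=> n d s x; rewrite !col_hom_act.
Defined.

(* P = F(E)/(R), where g is the map from the generating collection E to P. *)
Definition is_presentation (k : fieldType) (E : collection k) (P : operad k)
    (g : col_hom E P) (R : subcollection (free_operad E)) : Prop :=
  exists2 f : op_hom (presented_operad R) P, op_bijective f &
    forall n d (x : E n d), f n d (presented_gen R n d x) = g n d x.

Definition midx (n : nat) : Type := {ffun 'I_n.+1 -> int}.

Definition midx_le n (p q : midx n) : Prop := forall i, p i <= q i.
Definition midx_meet n (p q : midx n) : midx n :=
  [ffun i => Num.min (p i) (q i)].
Definition midx_const n (z : int) : midx n := [ffun => z].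
Definition midx_perm n (p : midx n) (s : 'S_n.+1) : midx n := [ffun i => p (s i)].

Definition midx_comp m n r (i : 'I_m.+1) (a : midx m) (b : midx n) : midx r :=
  [ffun u : 'I_r.+1 =>
    if (u < i)%N then a (inord u)
    else if (u <= i + n)%N then b (inord (u - i)) + a i
    else a (inord (u - n))].

Definition midx_bracket m n r (i : 'I_m.+1) (j : 'I_n.+1) (a : midx m)
    (b : midx n) : midx r :=
  [ffun u : 'I_r.+1 =>
    if (u < j)%N then b (inord u) + a i
    else if (u < i + j)%N then a (inord (u - j)) + b j
    else if u == (i + j)%N :> nat then a i + b j - 1
    else if (u <= i + n)%N then b (inord (u - i)) + a i
    else a (inord (u - n)) + b j].

Definition multifamily (k : fieldType) (P : operad k) : Type :=
  forall n d, midx n -> set (P n d).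

Record is_multifiltration (k : fieldType) (P : operad k) (F : multifamily P) :
    Prop := IsMultifiltration {
  mf_subspace : forall n d p, is_subspace (F n d p);
  mf_mono : forall n d p p', midx_le p p' -> F n d p `<=` F n d p';
  mf_act : forall n d p (s : 'S_n.+1),
    [set act s x | x in F n d p] = F n d (midx_perm p s);
  mf_comp : forall m n r (e : (m + n)%N = r) c d q (f : c + d = q) (i : 'I_m.+1)
      (p : midx m) (p' : midx n) (a : P m c) (b : P n d),
    F m c p a -> F n d p' b -> F r q (midx_comp r i p p') (comp e f i a b);
  mf_unit : F 0%N 0 (midx_const 0 0) (op_unit P)
}.

Definition is_saturated (k : fieldType) (P : operad k) (F : multifamily P) :
    Prop :=
  forall n d p p', F n d p `&` F n d p' = F n d (midx_meet p p').

Definition op_commutator (k : fieldType) (P : operad k)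
    m n r (e : (m + n)%N = r) c d q (f : c + d = q) (i : 'I_m.+1) (j : 'I_n.+1)
    (a : P m c) (b : P n d) : P r q :=
  act (nat_perm r (block_swap 0 i j)) (comp e f i a b) -
  (-1) ^ (c * d) *:
  act (nat_perm r (block_swap (i + j).+1 (m - i) (n - j)))
    (comp (etrans (addnC n m) e) (etrans (addrC d c) f) j b a).

Definition is_D_multifiltration (k : fieldType) (P : operad k)
    (F : multifamily P) : Prop :=
  is_multifiltration F /\
  forall m n r (e : (m + n)%N = r) c d q (f : c + d = q) (i : 'I_m.+1)
      (j : 'I_n.+1) (p : midx m) (p' : midx n) (a : P m c) (b : P n d),
    F m c p a -> F n d p' b ->
    F r q (midx_bracket r i j p p') (op_commutator e f i j a b).

Definition contains_generators (k : fieldType) (E : collection k) (P : operad k)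
    (g : col_hom E P) (F : multifamily P) : Prop :=
  forall n d (x : E n d), F n d (midx_const n 1) (g n d x).

Definition std_filtration (k : fieldType) (E : collection k) (P : operad k)
    (g : col_hom E P) : multifamily P :=
  fun n d p => [set x | forall F : multifamily P,
    is_D_multifiltration F -> is_saturated F -> contains_generators g F ->
    F n d p x].

Arguments std_filtration {k E P} g n d p _.

Lemma std_filtration_least (k : fieldType) (E : collection k) (P : operad k)
    (g : col_hom E P) :
  [/\ is_D_multifiltration (std_filtration g),
      is_saturated (std_filtration g),
      contains_generators g (std_filtration g)
    & forall F : multifamily P,
        is_D_multifiltration F -> is_saturated F -> contains_generators g F ->
        forall n d p, std_filtration g n d p `<=` F n d p].
Proof.
split; last by move=> F FD Fs Fg n d p x; apply.
- split; last first.
    move=> m n r e c d q f i j p p' a b ha hb F FD Fs Fg.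
    by case: (FD) => _; apply; [apply: ha|apply: hb].
  split.
  + move=> n d p; split=> [|c x y hx hy] F FD Fs Fg.
      by case: (mf_subspace (proj1 FD) d p).
    have [_] := mf_subspace (proj1 FD) d p.
    by apply; [apply: hx|apply: hy].
  + move=> n d p p' le x hx F FD Fs Fg.
    by apply: (mf_mono (proj1 FD) le); apply: hx.
  + have sub n d p (s : 'S_n.+1) x : std_filtration g n d p x ->
        std_filtration g n d (midx_perm p s) (act s x).
      move=> hx F FD Fs Fg; rewrite -(mf_act (proj1 FD)).
      by exists x => //; apply: hx.
    move=> n d p s; apply/seteqP; split=> [_ [x hx <-]|y hy]; first exact: sub.
    exists (act s^-1%g y); last by rewrite act_act mulgV act_id.
    suff -> : p = midx_perm (midx_perm p s) s^-1%g by apply: sub.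
    by apply/ffunP => i; rewrite !ffunE permKV.
  + move=> m n r e c d q f i p p' a b ha hb F FD Fs Fg.
    by apply: (mf_comp (proj1 FD)); [apply: ha|apply: hb].
  + by move=> F FD Fs Fg; apply: mf_unit; case: FD.
- move=> n d p p'; apply/seteqP; split=> [x [hx hx'] F FD Fs Fg|x hx].
    by rewrite -Fs; split; [apply: hx|apply: hx'].
  by split=> F FD Fs Fg; have := hx F FD Fs Fg; rewrite -Fs => -[].
- by move=> n d x F FD Fs Fg; apply: Fg.
Qed.

Definition is_tight (k : fieldType) (E : collection k) (P : operad k)
    (g : col_hom E P) : Prop :=
  exists2 R : subcollection (free_operad E),
    is_presentation g R &
    forall n d, R n d `<=` std_filtration (free_gen E) n d (midx_const n 1).

Definition two_generators (k : fieldType) (E : collection k) :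
    subcollection (free_operad E) :=
  fun r q => [set x | exists m n (e : (m + n)%N = r) c d (f : c + d = q) i
      (a : E m c) (b : E n d) (s : 'S_r.+1),
    x = act s (comp e f i (free_gen E m c a) (free_gen E n d b))].

Arguments two_generators {k} E n d _ : rename.

Definition is_quadratic (k : fieldType) (E : collection k) (P : operad k)
    (g : col_hom E P) : Prop :=
  exists2 R : subcollection (free_operad E),
    is_presentation g R &
    forall n d, R n d `<=` lin_span (two_generators E n d).

(* In characteristic 0 the nonzero cyclic Sigma_2-modules are the trivial, the
   sign and the regular one: mu can be chosen symmetric, antisymmetric or
   without symmetry. *)
Definition single_binary (k : fieldType) (E : collection k) : Prop :=
  (forall n d (x : E n d), n <> 1%N \/ d <> 0 -> x = 0) /\
  exists2 mu : E 1%N 0, mu <> 0 &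
    forall x, exists c : 'S_2 -> k, x = \sum_(s : 'S_2) c s *: act s mu.

Section BinaryCollection.
Variables (k : fieldType) (V : lmodType k) (rho : 'S_2 -> V -> V).
Hypothesis rho_linear : forall s (c : k) x y,
  rho s (c *: x + y) = c *: rho s x + rho s y.
Hypothesis rho_id : forall x, rho 1%g x = x.
Hypothesis rho_act : forall s t x, rho t (rho s x) = rho (t * s)%g x.

Definition binary_car (n : nat) (d : int) : lmodType k :=
  match n, d with
  | 1%N, Posz 0 => V
  | _, _ => GRing.Lmodule.clone k 'rV[k]_0 _
  end.

Definition binary_act n d : 'S_n.+1 -> binary_car n d -> binary_car n d :=
  match n, d return 'S_n.+1 -> binary_car n d -> binary_car n d with
  | 1%N, Posz 0 => rho
  | _, _ => fun _ x => x
  end.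

Definition binary_collection : collection k.
Proof.
by refine (@Collection k binary_car binary_act _ _ _);
  move=> [|[|n]] [[|d]|d] //=.
Defined.

End BinaryCollection.

Section LieOperads.
Variable k : fieldType.

(* f(x_(w 0), ..., x_(w n)) *)
Definition relabel (P : operad k) n d (w : 'S_n.+1) (f : P n d) : P n d :=
  act w^-1%g f.

Definition compose2 (P : operad k) (i : 'I_2) (a b : P 1%N 0) : P 2%N 0 :=
  comp (erefl : (1 + 1)%N = 2%N) (add0r 0) i a b.

Inductive single_relation (P : operad k) n0 d0 (x0 : P n0 d0) :
    subcollection P :=
| SingleRelation : single_relation x0 x0.

Fact sgn_linear (s : 'S_2) (c : k) (x y : k^o) :
  (-1) ^+ s *: (c *: x + y) = c *: ((-1) ^+ s *: x) + (-1) ^+ s *: y :> k^o.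
Proof. by rewrite scalerDr !scalerA mulrC. Qed.
Fact sgn_id (x : k^o) : (-1) ^+ (1%g : 'S_2) *: x = x.
Proof. by rewrite odd_perm1 scale1r. Qed.
Fact sgn_act (s t : 'S_2) (x : k^o) :
  (-1) ^+ t *: ((-1) ^+ s *: x) = (-1) ^+ (t * s)%g *: x.
Proof. by rewrite scalerA odd_permM signr_addb. Qed.

Definition Lie_collection : collection k :=
  binary_collection (V := GRing.Lmodule.clone k k^o _) sgn_linear sgn_id sgn_act.

Definition Lie_bracket : free_operad Lie_collection 1%N 0 :=
  free_gen Lie_collection 1%N 0 (1 : k^o).

(* [1,[2,3]] + [2,[3,1]] + [3,[1,2]] *)
Definition jacobi : free_operad Lie_collection 2%N 0 :=
  let J := compose2 (inord 1) Lie_bracket Lie_bracket in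
  J + relabel (nat_perm 2 (nth 0%N [:: 1; 2; 0]%N)) J
    + relabel (nat_perm 2 (nth 0%N [:: 2; 0; 1]%N)) J.

Definition Lie_relations := single_relation jacobi.
Definition Lie_operad : operad k := presented_operad Lie_relations.
Definition Lie_gen : col_hom Lie_collection Lie_operad :=
  presented_gen Lie_relations.

(* The regular right Sigma_2-module, freely generated by the delta at 1. *)
Definition regular_act (s : 'S_2) (h : {ffun 'S_2 -> k^o}) :
    {ffun 'S_2 -> k^o} :=
  [ffun t => h (t * s)%g].
Fact regular_linear s (c : k) x y :
  regular_act s (c *: x + y) = c *: regular_act s x + regular_act s y.
Proof. by apply/ffunP => t; rewrite !ffunE. Qed.
Fact regular_id x : regular_act 1%g x = x.
Proof. by apply/ffunP => t; rewrite !ffunE mulg1. Qed.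
Fact regular_act_act s t x :
  regular_act t (regular_act s x) = regular_act (t * s)%g x.
Proof. by apply/ffunP => u; rewrite !ffunE mulgA. Qed.

Definition LieAdm_collection : collection k :=
  binary_collection (V := GRing.Lmodule.clone k {ffun 'S_2 -> k^o} _)
    regular_linear regular_id regular_act_act.

Definition LieAdm_product : free_operad LieAdm_collection 1%N 0 :=
  free_gen LieAdm_collection 1%N 0 ([ffun s => (s == 1%g)%:R] : {ffun 'S_2 -> k^o}).

(* ((1,2),3) - (1,(2,3)) *)
Definition associator : free_operad LieAdm_collection 2%N 0 :=
  compose2 ord0 LieAdm_product LieAdm_product -
  compose2 (inord 1) LieAdm_product LieAdm_product.

Definition LieAdm_relation : free_operad LieAdm_collection 2%N 0 :=
  \sum_(s : 'S_3) (-1) ^+ s *: relabel s associator.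

Definition LieAdm_relations := single_relation LieAdm_relation.
Definition LieAdm_operad : operad k := presented_operad LieAdm_relations.
Definition LieAdm_gen : col_hom LieAdm_collection LieAdm_operad :=
  presented_gen LieAdm_relations.

End LieOperads.

(* Main.v *)
(** Split the generators of arity 2 into a symmetric part p and an antisymmetric
    part m.  Then F(E)(3) is spanned by the composites x(y(i,j),l) with x, y in
    {p, m}, i.e. by three 2x2 blocks indexed by the outer variable l.  On a model
    of F(E) truncated above arity 3, "order at most 1 in the variable i" can be
    imposed as the linear condition on the two blocks with outer variable
    different from i that holds for operadic commutators.  This gives a saturated
    D-multifiltration, hence an upper bound for the standard one.  Imposing the
    condition in all three variables makes the blocks eigenvectors, for the
    eigenvalue -1, of a cyclic operator on 2x2 matrices, and the only one is
    m (x) m: the order (1,1,1) part of F(E)(3) is spanned by the Jacobiator of m.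
    Conversely, the Jacobiator of an antisymmetric element of order (1,1) is of
    order (1,1,1).  So a tight quadratic operad is free or has the Jacobiator of
    m as its only relation; it is then Lie if p = 0 and LieAdm otherwise. *)
From mathcomp Require Import all_boot all_order all_algebra fingroup perm.
From mathcomp Require Import boolp classical_sets.
From mathcomp Require Import zify ring.
Require Import Defs.

Set Implicit Arguments.
Unset Strict Implicit.
Unset Printing Implicit Defensive.

Import Order.TTheory GRing.Theory Num.Theory.
Local Open Scope ring_scope.

(** * Permutations of two and three letters *)

(** [free_operad] consists of formal terms modulo a congruence and comes with no basis, and the
    standard filtration is an intersection over all saturated D-multifiltrations; neither can be
    inspected elementwise. Hence the model: the universal property yields [to_model], a
    multifiltration of the model pulls back to a competitor in that intersection, and in arity 3 a
    left inverse of [to_model] turns equations between matrices back into equations in F(E). The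
    truncation is harmless, as quadratic relations between binary generators live in arity 3. Inputs
    of ternary operations are read in Z/3, so that ['S_3] becomes the affine group and the outer
    variable is translated cyclically. Tightness and quadraticity may be witnessed by different
    relations; what they share is the ideal, the kernel of the same map to P. *)

Lemma ord2P (P : 'I_2 -> Prop) : P 0 -> P 1 -> forall i, P i.
Proof.
move=> P0 P1 [[|[|//]] lt].
- by rewrite (_ : Ordinal lt = 0) //; apply: val_inj.
- by rewrite (_ : Ordinal lt = 1) //; apply: val_inj.
Qed.

Lemma ord3P (P : 'I_3 -> Prop) : P 0 -> P 1 -> P (-1) -> forall i, P i.
Proof.
move=> P0 P1 P2 [[|[|[|//]]] lt].
- by rewrite (_ : Ordinal lt = 0) //; apply: val_inj.
- by rewrite (_ : Ordinal lt = 1) //; apply: val_inj.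
- by rewrite (_ : Ordinal lt = -1) //; apply: val_inj.
Qed.

Definition swap2 : 'S_2 := tperm 0 1.

Lemma perm2P (P : 'S_2 -> Prop) : P 1%g -> P swap2 -> forall s, P s.
Proof.
move=> P1 Pt s; have [s0|s0] := eqVneq (s 0) 0.
  suff -> : s = 1%g by [].
  apply/permP; elim/ord2P; rewrite perm1 //.
  have : s 1 != s 0 by rewrite (inj_eq perm_inj).
  by rewrite s0; elim/ord2P: (s 1).
suff -> : s = swap2 by [].
have s0E : s 0 = 1 by move: s0; elim/ord2P: (s 0).
apply/permP; elim/ord2P; rewrite ?tpermL ?tpermR //.
have : s 1 != s 0 by rewrite (inj_eq perm_inj).
by rewrite s0E; elim/ord2P: (s 1).
Qed.

Lemma perm2_neq : swap2 != 1%g.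
Proof. by apply/eqP => /permP /(_ 0); rewrite tpermL perm1. Qed.

Lemma swap2K : (swap2 * swap2 = 1)%g.
Proof. exact: tperm2. Qed.

Lemma odd_swap2 : odd_perm swap2.
Proof. by rewrite odd_tperm. Qed.

Lemma sum_perm2 (V : zmodType) (F : 'S_2 -> V) :
  \sum_s F s = F 1%g + F swap2.
Proof.
rewrite (bigD1 1%g) //= (bigD1 swap2) ?perm2_neq //= big1 ?addr0 //.
by move=> s; elim/perm2P: s; rewrite !eqxx ?andbF.
Qed.

(* 'S_3 as the affine group of Z/3: the even permutations are the
   translations, the odd ones the reflections. *)
Definition affine_fun (b : bool) (z j : 'I_3) : 'I_3 := z + (-1) ^+ b * j.

Fact affine_inj b z : injective (affine_fun b z).
Proof. by move=> i j /addrI /(mulrI (unitrX b (unitrN1 _))). Qed.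

Definition affine b z : 'S_3 := perm (@affine_inj b z).

Lemma affineE b z j : affine b z j = z + (-1) ^+ b * j.
Proof. by rewrite permE. Qed.

Lemma affineM b z c w :
  (affine b z * affine c w = affine (b (+) c) (w + (-1) ^+ c * z))%g.
Proof.
apply/permP => j; rewrite permM !affineE signr_addb mulrDr addrA mulrA.
by rewrite [(-1) ^+ c * (-1) ^+ b]mulrC.
Qed.

Lemma affine0 : affine false 0 = 1%g.
Proof. by apply/permP => j; rewrite affineE perm1 add0r expr0 mul1r. Qed.

Lemma affine_tperm : affine true 1 = tperm 0 1.
Proof.
apply/permP; elim/ord3P; rewrite affineE ?tpermL ?tpermR ?tpermD //;
exact/val_inj.
Qed.

(** In Z/3 one has w = -w - w, so every translation is a square, hence even; a reflection is a
    translation composed with the transposition of 0 and 1. *)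
Lemma odd_affine b z : odd_perm (affine b z) = b.
Proof.
have even w : odd_perm (affine false w) = false.
  have -> : affine false w = (affine false (- w) * affine false (- w))%g.
    rewrite affineM expr0 mul1r; congr affine.
    by elim/ord3P: w; apply: val_inj.
  by rewrite odd_permM addbb.
case: b => //.
have -> : affine true z = (tperm 0%R 1%R * affine false (z - 1))%g.
  by rewrite -affine_tperm affineM addbF expr0 mul1r subrK.
by rewrite odd_permM even odd_tperm.
Qed.

Lemma perm3P (s : 'S_3) : s = affine (odd_perm s) (s 0).
Proof.
suff [b ->] : exists b, s = affine b (s 0).
  by rewrite odd_affine affineE mulr0 addr0.
have n01 : s 1 != s 0 by rewrite (inj_eq perm_inj).
have n02 : s (-1) != s 0 by rewrite (inj_eq perm_inj).
have n12 : s (-1) != s 1 by rewrite (inj_eq perm_inj).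
(* A permutation of Z/3 keeps the cyclic order exactly if it sends 1 to the successor of the image
   of 0. *)
exists (s 1 != s 0 + 1); apply/permP => j; rewrite affineE.
move: j n01 n02 n12; elim/ord3P;
by elim/ord3P: (s 0); elim/ord3P: (s 1); elim/ord3P: (s (-1)) => // *;
  apply: val_inj.
Qed.

Lemma perm3E (s : 'S_3) j : s j = s 0 + (-1) ^+ (s : bool) * j.
Proof. by rewrite {1}[s]perm3P affineE. Qed.

Lemma perm3_eq (b : bool) z (s : 'S_3) :
  s 0 = z -> s 1 = z + (-1) ^+ b -> s = affine b z.
Proof.
move=> s0 s1; rewrite [s]perm3P s0; congr affine.
move: s1; rewrite perm3E s0 mulr1 => /addrI.
by case: (odd_perm s); case: b => // /(congr1 val).
Qed.

Lemma sum_perm3 (V : zmodType) (F : 'S_3 -> V) :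
  \sum_s F s = \sum_b \sum_z F (affine b z).
Proof.
rewrite pair_big /= (reindex (fun x : bool * 'I_3 => affine x.1 x.2)) //=.
exists (fun s : 'S_3 => (odd_perm s, s 0)) => [[b z] _|s _] /=.
  by rewrite odd_affine affineE mulr0 addr0.
by rewrite -perm3P.
Qed.

(** * The truncated model *)

Lemma nat_perm_id n (f : nat -> nat) :
  (forall i, (i <= n)%N -> f i = i) -> nat_perm n f = 1%g.
Proof.
move=> fE; apply/permP => i; apply: val_inj; rewrite /= perm1 nat_permE ?fE //.
- by rewrite -ltnS.
- by move=> j le; rewrite fE.
- by move=> j l lej lel; rewrite !fE.
Qed.

Lemma perm_comp_id m (i : 'I_m.+1) (s : 'S_m.+1) : perm_comp m s i (1%g : 'S_1) = s.
Proof.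
apply/permP => j; apply: val_inj; rewrite /= perm_compE ?addn0 //.
rewrite /perm_comp_fun !addn0 perm1 subn0 inord_val.
case: ltngtP => [|lt|eq]; rewrite ?if_same //.
rewrite (ord_inj (esym eq)) subnn (_ : inord 0 = ord0) ?addn0 //.
by apply: val_inj; rewrite /= inordK.
Qed.

Lemma perm_id_comp n (i : 'I_1) (s : 'S_1) (t : 'S_n.+1) : perm_comp n s i t = t.
Proof.
apply/permP => j; apply: val_inj; rewrite /= perm_compE //.
rewrite /perm_comp_fun !ord1 /= add0n subn0 inord_val.
by rewrite -ltnS ltn_ord.
Qed.

Lemma inord2 : (inord 0 = 0 :> 'I_2) * (inord 1 = 1 :> 'I_2).
Proof. by split; apply: val_inj; rewrite /= inordK. Qed.

(* The input of a o_i b not entering b, for binary a and b. *)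
Definition outer_input (i : 'I_2) : 'I_3 := if i == 0 then -1 else 0.

(** Moving a block of two inputs past a single one is a 3-cycle, so the parity is that of [t]; the
    translation part is forced because the outer input for [i] goes to the one for [s i]. *)
Lemma perm_comp_binary (s : 'S_2) (i : 'I_2) (t : 'S_2) :
  perm_comp 2 s i t =
  affine t (outer_input (s i) - (-1) ^+ t * outer_input i).
Proof.
apply: perm3_eq; apply: val_inj; rewrite /= perm_compE // /perm_comp_fun;
by elim/perm2P: s; elim/perm2P: t; elim/ord2P: i;
  rewrite /= ?(inord2, perm1, tpermL, tpermR, odd_perm1, odd_swap2).
Qed.

Section Model.
Variable k : fieldType.

(** The matrix of a permutation of parity [b] on a symmetric generator (index 0) and an
    antisymmetric one (index 1). *)
Definition flip (b : bool) : 'M[k]_2 :=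
  diag_mx (\row_j (-1) ^+ (b && (j == 1))).

Lemma flip0 : flip false = 1%:M.
Proof. by rewrite -diag_const_mx; congr diag_mx; apply/rowP => j; rewrite !mxE. Qed.

Lemma flipM b c : flip b *m flip c = flip (b (+) c).
Proof.
rewrite mulmx_diag; congr diag_mx; apply/rowP => j; rewrite !mxE -signr_addb.
by case: b; case: c; case: (j == 1).
Qed.

Lemma tr_flip b : (flip b)^T = flip b.
Proof. exact: tr_diag_mx. Qed.

Lemma mul_flipE m (A : 'M_(m, 2)) b i j :
  (A *m flip b) i j = (-1) ^+ (b && (j == 1)) * A i j.
Proof. by rewrite mul_mx_diag !mxE mulrC. Qed.

(* The carrier of the model operad in every arity and degree: its elements
   encode binary operations by a pair of coordinates, and ternary ones by the
   coefficient matrices u z of the composites x(y(z+1,z+2),z), where x and y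
   are the symmetric or the antisymmetric generator; in arity 1 only the scalar
   [coef] matters, and composites of arity at least 4 vanish. *)
Definition model_car : lmodType k := {ffun 'I_3 -> 'M[k]_2}.

Definition pair_of (u : model_car) : 'rV[k]_2 := row 0 (u 0).
Definition coef (c : int) (u : model_car) : k := if c == 0 then u 0 0 0 else 0.
Definition model_unit : model_car := [ffun=> delta_mx 0 0].

(** In the ternary case an odd [s] reverses the cyclic order of the two inner variables, which acts
    on the inner generator, that is on columns, by its symmetry. *)
Definition model_act_fun n : 'S_n.+1 -> model_car -> model_car :=
  match n with
  | 1%N => fun s u => [ffun z => u z *m flip s]
  | 2%N => fun s u => [ffun z => u (s z) *m flip s]
  | _ => fun _ u => u
  end.

(** Rows belong to the outer operation, columns to the inner one. At input 1 the outer operation is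
    turned so that the inner one fills its first slot, whence the flip of [a]. *)
Definition model_comp2 (i : 'I_2) (a b : model_car) : model_car :=
  [ffun z => if z == outer_input i
             then (pair_of a *m flip (i == 1))^T *m pair_of b else 0].

(** Two unary elements are multiplied in the square-zero extension of k by the kernel of [coef]: (x
    + a')(y + b') = xy + xb' + ya' for scalars x, y. So [model_unit] is a unit although the carrier
    is larger than k. *)
Definition model_comp_fun (m n : nat) (c d : int) (i : nat) (a b : model_car) :
    model_car :=
  match m, n with
  | 0%N, 0%N => coef c a *: b + coef d b *: a - (coef c a * coef d b) *: model_unit
  | 0%N, _.+1 => coef c a *: b
  | _.+1, 0%N => coef d b *: a
  | 1%N, 1%N =>
    if (c == 0) && (d == 0) then model_comp2 (inord i) a b else 0
  | _, _ => 0
  end.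

Lemma coef_linear c z (u v : model_car) :
  coef c (z *: u + v) = z * coef c u + coef c v.
Proof. by rewrite /coef; case: eqP; rewrite ?mulr0 ?addr0 // !ffunE !mxE. Qed.

Lemma coef0 c : coef c 0 = 0.
Proof. by rewrite /coef ffunE mxE if_same. Qed.

Lemma coef_unit : coef 0 model_unit = 1.
Proof. by rewrite /coef eqxx ffunE mxE. Qed.

Lemma pair_of_linear z (u v : model_car) :
  pair_of (z *: u + v) = z *: pair_of u + pair_of v.
Proof. by apply/rowP => j; rewrite !(mxE, ffunE). Qed.

Lemma pair_of0 : pair_of 0 = 0.
Proof. by apply/rowP => j; rewrite !(mxE, ffunE). Qed.

Lemma pair_of_act (s : 'S_2) u :
  pair_of (@model_act_fun 1 s u) = pair_of u *m flip s.
Proof. by rewrite /pair_of ffunE row_mul. Qed.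

Fact model_act_linear n (s : 'S_n.+1) z (u v : model_car) :
  model_act_fun s (z *: u + v) = z *: model_act_fun s u + model_act_fun s v.
Proof.
case: n s => [|[|[|n]]] s //; apply/ffunP => j;
by rewrite !ffunE mulmxDl scalemxAl.
Qed.

Fact model_act_id n u : @model_act_fun n 1%g u = u.
Proof.
case: n => [|[|[|n]]] //; apply/ffunP => j;
by rewrite !ffunE odd_perm1 flip0 mulmx1 ?perm1.
Qed.

Fact model_act_act n (s t : 'S_n.+1) u :
  model_act_fun t (model_act_fun s u) = model_act_fun (t * s)%g u.
Proof.
case: n s t => [|[|[|n]]] s t //; apply/ffunP => j;
by rewrite !ffunE -mulmxA flipM odd_permM addbC ?permM.
Qed.

Definition model_collection : collection k :=
  @Collection k (fun _ _ => model_car) (fun n _ => @model_act_fun n)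
    (fun n _ => @model_act_linear n) (fun n _ => @model_act_id n)
    (fun n _ => @model_act_act n).

Lemma model_comp2_linear_l i z a a' b :
  model_comp2 i (z *: a + a') b = z *: model_comp2 i a b + model_comp2 i a' b.
Proof.
apply/ffunP => j; rewrite !ffunE; case: eqP => _; last by rewrite scaler0 addr0.
by rewrite pair_of_linear mulmxDl -scalemxAl linearD linearZ mulmxDl -scalemxAl.
Qed.

Lemma model_comp2_linear_r i z a b b' :
  model_comp2 i a (z *: b + b') = z *: model_comp2 i a b + model_comp2 i a b'.
Proof.
apply/ffunP => j; rewrite !ffunE; case: eqP => _; last by rewrite scaler0 addr0.
by rewrite pair_of_linear mulmxDr -scalemxAr.
Qed.

Lemma model_comp2_act (s : 'S_2) (i : 'I_2) (t : 'S_2) a b :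
  model_comp2 i (@model_act_fun 1 s a) (@model_act_fun 1 t b) =
  @model_act_fun 2 (perm_comp 2 s i t) (model_comp2 (s i) a b).
Proof.
apply/ffunP => j; rewrite !ffunE.
have -> : (perm_comp 2 s i t j == outer_input (s i)) = (j == outer_input i).
  rewrite -(inj_eq (@perm_inj _ (perm_comp 2 s i t)) j); congr (_ == _).
  by rewrite perm_comp_binary affineE subrK.
case: eqP => _; last by rewrite mul0mx.
rewrite perm_comp_binary odd_affine !pair_of_act -!mulmxA; congr (_^T *m _).
rewrite flipM; congr (_ *m flip _).
by elim/perm2P: s; elim/ord2P: i; rewrite ?perm1 ?tpermL ?tpermR ?odd_perm1 ?odd_swap2.
Qed.

Fact model_comp_linear_l m n c d i z (a a' b : model_car) :
  model_comp_fun m n c d i (z *: a + a') b =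
  z *: model_comp_fun m n c d i a b + model_comp_fun m n c d i a' b.
Proof.
case: m n => [|[|m]] [|[|n]] /=.
- apply/ffunP => j; apply/matrixP => x y; rewrite coef_linear !(ffunE, mxE); ring.
- by rewrite coef_linear scalerDl scalerA.
- by rewrite coef_linear scalerDl scalerA.
- by rewrite scalerDr !scalerA mulrC.
- by case: ifP => _; rewrite ?scaler0 ?addr0 // model_comp2_linear_l.
- by rewrite scaler0 addr0.
- by rewrite scalerDr !scalerA mulrC.
- by rewrite scaler0 addr0.
- by rewrite scaler0 addr0.
Qed.

Lemma model_comp_funC c d i j a b :
  model_comp_fun 0 0 c d i a b = model_comp_fun 0 0 d c j b a.
Proof. by rewrite /= [coef d b * _]mulrC [coef d b *: a + _]addrC. Qed.

Fact model_comp_linear_r m n c d i z (a b b' : model_car) :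
  model_comp_fun m n c d i a (z *: b + b') =
  z *: model_comp_fun m n c d i a b + model_comp_fun m n c d i a b'.
Proof.
case: m n => [|[|m]] [|[|n]].
- by rewrite !(model_comp_funC c d i i) model_comp_linear_l.
- by rewrite /= scalerDr !scalerA mulrC.
- by rewrite /= scalerDr !scalerA mulrC.
- by rewrite /= coef_linear scalerDl scalerA.
- by rewrite /=; case: ifP => _; rewrite ?scaler0 ?addr0 // model_comp2_linear_r.
- by rewrite /= scaler0 addr0.
- by rewrite /= coef_linear scalerDl scalerA.
- by rewrite /= scaler0 addr0.
- by rewrite /= scaler0 addr0.
Qed.

Lemma model_comp_0l m n c d i b : model_comp_fun m n c d i 0 b = 0.
Proof. by have := model_comp_linear_l m n c d i (-1) 0 0 b;
  rewrite !scaleN1r oppr0 addr0 addNr. Qed.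

Lemma model_comp_0r m n c d i a : model_comp_fun m n c d i a 0 = 0.
Proof. by have := model_comp_linear_r m n c d i (-1) a 0 0;
  rewrite !scaleN1r oppr0 addr0 addNr. Qed.

Lemma model_comp_Zl m n c d i z a b :
  model_comp_fun m n c d i (z *: a) b = z *: model_comp_fun m n c d i a b.
Proof. by rewrite -[z *: a]addr0 model_comp_linear_l model_comp_0l addr0. Qed.

Lemma model_comp_Zr m n c d i z a b :
  model_comp_fun m n c d i a (z *: b) = z *: model_comp_fun m n c d i a b.
Proof. by rewrite -[z *: b]addr0 model_comp_linear_r model_comp_0r addr0. Qed.

Lemma coef_comp c d i a b :
  coef (c + d) (model_comp_fun 0 0 c d i a b) = coef c a * coef d b.
Proof.
have coefE e x y z w (u v : model_car) : coef e (x *: u + y *: v - z *: w) =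
    x * coef e u + y * coef e v - z * coef e w.
  rewrite /coef; case: (e == 0); last by ring.
  by rewrite !(ffunE, mxE).
rewrite /= coefE.
have [->|c0] := eqVneq c 0.
  rewrite add0r; have [->|d0] := eqVneq d 0; first by rewrite coef_unit; ring.
  by rewrite {3 5 6}/coef (negbTE d0); ring.
have [->|d0] := eqVneq d 0; first by rewrite addr0 /coef eqxx (negbTE c0); ring.
by rewrite /coef (negbTE c0) (negbTE d0); ring.
Qed.

Fact model_comp_unit_l n d i (a : model_car) :
  model_comp_fun 0 n 0 d i model_unit a = a.
Proof.
case: n => [|n] /=; rewrite coef_unit ?scale1r //.
by rewrite mul1r addrK.
Qed.

Fact model_comp_unit_r n d i (a : model_car) :
  model_comp_fun n 0 d 0 i a model_unit = a.
Proof.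
case: n => [|[|n]]; first by rewrite (model_comp_funC d 0 i 0) model_comp_unit_l.
all: by rewrite /= coef_unit scale1r.
Qed.

Lemma model_comp00 c d i a b :
  model_comp_fun 0 0 c d i a b =
  coef c a *: b + coef d b *: a - (coef c a * coef d b) *: model_unit.
Proof. by []. Qed.

Lemma model_comp0S n c d i a b :
  model_comp_fun 0 n.+1 c d i a b = coef c a *: b.
Proof. by []. Qed.

Lemma model_compS0 n c d i a b :
  model_comp_fun n.+1 0 c d i a b = coef d b *: a.
Proof. by case: n. Qed.

Lemma model_comp11 c d i a b :
  model_comp_fun 1 1 c d i a b =
  if (c == 0) && (d == 0) then model_comp2 (inord i) a b else 0.
Proof. by []. Qed.

Lemma model_compSS m n c d i a b :
  (0 < m + n)%N -> model_comp_fun m.+1 n.+1 c d i a b = 0.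
Proof. by case: m n => [|m] [|n]. Qed.

Lemma coef_neq0 (e : int) u : coef e u != 0 -> e = 0.
Proof. by rewrite /coef; case: (e =P 0) => //; rewrite eqxx. Qed.

#[local] Arguments model_comp_fun : simpl never.

(** If all three arities are at least 2, both sides have arity at least 4 and vanish. Otherwise a
    unary factor acts through its scalar, which is nonzero only in degree 0, so the degree tests on
    the two sides agree; three unary factors are the associativity of the square-zero extension. *)
Fact model_comp_seq (l m n : nat) b c d (i j : nat) (x y z : model_car) :
  (i <= l)%N -> (j <= m)%N ->
  model_comp_fun (l + m) n (b + c) d (i + j) (model_comp_fun l m b c i x y) z =
  model_comp_fun l (m + n) b (c + d) i x (model_comp_fun m n c d j y z).
Proof.
case: l m n => [|l] [|m] [|n] il jm.
- rewrite !addn0 [LHS]model_comp00 [RHS]model_comp00 !coef_comp !model_comp00.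
  by apply/ffunP => r; apply/matrixP => s t; rewrite !(ffunE, mxE); ring.
- by rewrite !add0n !model_comp0S coef_comp scalerA.
- by rewrite addn0 add0n model_comp0S model_compS0 model_comp0S model_compS0
    !scalerA mulrC.
- move: il; rewrite leqn0 => /eqP ->.
  rewrite !add0n addSn !model_comp0S model_comp_Zl.
  have [->|/coef_neq0 ->] := eqVneq (coef b x) 0; first by rewrite !scale0r.
  by rewrite add0r.
- by rewrite !addn0 !model_compS0 coef_comp scalerA mulrC.
- move: jm; rewrite leqn0 => /eqP ->.
  rewrite !addn0 add0n model_compS0 model_comp0S model_comp_Zl model_comp_Zr.
  have [->|/coef_neq0 ->] := eqVneq (coef c y) 0; first by rewrite !scale0r.
  by rewrite addr0 add0r.
- rewrite addn0 addSn !model_compS0 model_comp_Zr.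
  have [->|/coef_neq0 ->] := eqVneq (coef d z) 0; first by rewrite !scale0r.
  by rewrite addr0.
- by rewrite !addSn !model_compSS ?addnS.
Qed.

Fact model_comp_par (l m n : nat) b c d (i j : nat) (x y z : model_car) :
  (0 < l)%N ->
  model_comp_fun (l + m) n (b + c) d (j + m) (model_comp_fun l m b c i x y) z =
  (-1) ^ (c * d) *:
  model_comp_fun (l + n) m (b + d) c i (model_comp_fun l n b d j x z) y.
Proof.
case: l m n => [|l] [|m] [|n] // _.
- rewrite !addn0 !model_compS0 !scalerA.
  have [-> | /coef_neq0 ->] := eqVneq (coef c y) 0; first by rewrite !(mulr0, mul0r).
  by rewrite mul0r expr0z mul1r mulrC.
- rewrite !addn0 addSn !model_compS0 model_comp_Zl.
  have [-> | /coef_neq0 ->] := eqVneq (coef c y) 0; first by rewrite !scale0r scaler0.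
  by rewrite mul0r expr0z scale1r addr0.
- rewrite !addn0 addSn !model_compS0 model_comp_Zl.
  have [-> | /coef_neq0 ->] := eqVneq (coef d z) 0; first by rewrite !scale0r scaler0.
  by rewrite mulr0 expr0z scale1r addr0.
- by rewrite !addSn !model_compSS ?addnS // scaler0.
Qed.

Fact model_comp_act m n r (e : (m + n)%N = r) c d (i : 'I_m.+1) (s : 'S_m.+1)
    (t : 'S_n.+1) a b :
  model_comp_fun m n c d i (model_act_fun s a) (model_act_fun t b) =
  model_act_fun (perm_comp r s i t) (model_comp_fun m n c d (s i) a b).
Proof.
have actZ p (u : 'S_p.+1) z x : model_act_fun u (z *: x) = z *: model_act_fun u x.
  by have := model_act_linear u (z - 1) x x; rewrite -[X in _ + X]scale1r
    -[X in _ = _ + X]scale1r -!scalerDl subrK.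
have act0 p (u : 'S_p.+1) : model_act_fun u 0 = 0.
  by have := actZ p u 0 0; rewrite !scale0r.
have coef_act p (u : 'S_1) x : coef p (model_act_fun u x) = coef p x by [].
case: m n e i s t => [|m] [|n] e i s t.
- by case: r / e; rewrite !model_comp00.
- by case: r / e; rewrite !model_comp0S coef_act -actZ perm_id_comp.
- have {}e : m.+1 = r by rewrite -e addn0.
  case: r / e; rewrite !model_compS0 coef_act actZ.
  by have -> : t = 1%g; [apply/permP => j; rewrite !ord1 | rewrite perm_comp_id].
- case: m n e i s t => [|m] [|n] e i s t; try by rewrite !model_compSS ?addnS ?act0.
  case: r / e; rewrite !model_comp11 !inord_val; case: ifP => _.
    exact: model_comp2_act.
  by rewrite act0.
Qed.

Lemma model_comp2_0l i b : model_comp2 i 0 b = 0.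
Proof. by apply/ffunP => j; rewrite !ffunE pair_of0 mul0mx linear0 mul0mx if_same. Qed.

Lemma model_comp2_0r i a : model_comp2 i a 0 = 0.
Proof. by apply/ffunP => j; rewrite !ffunE pair_of0 mulmx0 if_same. Qed.

Definition model_operad : operad k.
Proof.
refine (@Operad k model_collection model_unit
  (fun m n _ _ c d _ _ i a b => model_comp_fun m n c d i a b) _ _ _ _ _ _ _).
- by move=> m n r e c d q f i z a a' b; apply: model_comp_linear_l.
- by move=> m n r e c d q f i z a b b'; apply: model_comp_linear_r.
- by move=> n e d f i a; apply: model_comp_unit_l.
- by move=> n e d f i a; apply: model_comp_unit_r.
- move=> l m n r s t e1 e2 e3 e4 b c d p q o f1 f2 f3 f4 i j u x y z ->.
  move: i j u; subst => i j u; apply: model_comp_seq; rewrite -ltnS; exact: ltn_ord.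
- move=> l m n r s t e1 e2 e3 e4 b c d p q o f1 f2 f3 f4 i j u v x y z ij -> ->.
  move: i j u v ij; subst => i j u v ij; apply: model_comp_par.
  by apply: leq_ltn_trans (_ : i < l)%N => //; apply: leq_trans ij _; rewrite -ltnS.
- by move=> m n r e c d q f i s t a b; apply: model_comp_act.
Defined.

End Model.

(** * Linearity and induction in operads *)

Section CollectionBasics.
Variables (k : fieldType) (C : collection k) (n : nat) (d : int).
Implicit Types (s : 'S_n.+1) (x y : C n d).

Lemma act0 s : act s (0 : C n d) = 0.
Proof. by have := act_linear s (-1) (0 : C n d) 0; rewrite !scaleN1r !addNr. Qed.

Lemma actD s x y : act s (x + y) = act s x + act s y.
Proof. by rewrite -[x]scale1r act_linear !scale1r. Qed.

Lemma actZ s z x : act s (z *: x) = z *: act s x.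
Proof. by rewrite -[z *: x]addr0 act_linear act0 addr0. Qed.

Lemma actN s x : act s (- x) = - act s x.
Proof. by rewrite -scaleN1r actZ scaleN1r. Qed.

Lemma act_sum s (I : finType) (F : I -> C n d) :
  act s (\sum_i F i) = \sum_i act s (F i).
Proof. by apply: (big_morph (act s)) => [x y|]; [apply: actD|apply: act0]. Qed.

End CollectionBasics.

Section OperadBasics.
Variables (k : fieldType) (P : operad k).
Variables (m n r : nat) (e : (m + n)%N = r) (c d q : int) (f : c + d = q).
Implicit Types (i : 'I_m.+1) (a : P m c) (b : P n d).

Lemma comp_0l i b : comp e f i (0 : P m c) b = 0.
Proof. by have := comp_linear_l e f i (-1) (0 : P m c) 0 b; rewrite !scaleN1r !addNr. Qed.

Lemma comp_0r i a : comp e f i a (0 : P n d) = 0.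
Proof. by have := comp_linear_r e f i (-1) a (0 : P n d) 0; rewrite !scaleN1r !addNr. Qed.

Lemma compDl i a a' b : comp e f i (a + a') b = comp e f i a b + comp e f i a' b.
Proof. by rewrite -[a]scale1r comp_linear_l !scale1r. Qed.

Lemma compDr i a b b' : comp e f i a (b + b') = comp e f i a b + comp e f i a b'.
Proof. by rewrite -[b]scale1r comp_linear_r !scale1r. Qed.

Lemma compZl i z a b : comp e f i (z *: a) b = z *: comp e f i a b.
Proof. by rewrite -[z *: a]addr0 comp_linear_l comp_0l addr0. Qed.

Lemma compZr i z a b : comp e f i a (z *: b) = z *: comp e f i a b.
Proof. by rewrite -[z *: b]addr0 comp_linear_r comp_0r addr0. Qed.

Lemma compNl i a b : comp e f i (- a) b = - comp e f i a b.
Proof. by rewrite -scaleN1r compZl scaleN1r. Qed.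

Lemma compNr i a b : comp e f i a (- b) = - comp e f i a b.
Proof. by rewrite -scaleN1r compZr scaleN1r. Qed.

End OperadBasics.

Lemma lin_span_sub (k : fieldType) (V : lmodType k) (A B : set V) :
  is_subspace B -> (A `<=` B)%classic -> (lin_span A `<=` B)%classic.
Proof. by move=> sB AB x; apply. Qed.

Lemma lin_span_subspace (k : fieldType) (V : lmodType k) (A : set V) : is_subspace (lin_span A).
Proof.
split=> [|c x y hx hy] B [sB AB]; first by case: sB.
by case: (sB) => _; apply; [apply: hx|apply: hy].
Qed.

Lemma lin_span_mem (k : fieldType) (V : lmodType k) (A : set V) x : A x -> lin_span A x.
Proof. by move=> Ax B [_]; apply. Qed.

Lemma free_operad_ind (k : fieldType) (E : collection k)
    (S : subcollection (free_operad E)) :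
  (forall n d, is_subspace (S n d)) ->
  (forall n d (s : 'S_n.+1) x, S n d x -> S n d (act s x)) ->
  S 0%N 0 (op_unit (free_operad E)) ->
  (forall m n r (e : (m + n)%N = r) c d q (f : c + d = q) i a b,
    S m c a -> S n d b -> S r q (comp e f i a b)) ->
  (forall n d x, S n d (free_gen E n d x)) ->
  forall n d x, S n d x.
Proof.
move=> sS Sact Sunit Scomp Sgen n d; elim/quot_ind=> x; elim: x => {n d}.
- by move=> n d; apply: subspace0 (sS n d).
- move=> n d x IHx y IHy; rewrite (to_quotD (V := fterm_premodule E n d)).
  exact: subspaceD (sS n d) _ _ IHx IHy.
- move=> n d c x IHx; rewrite (to_quotZ (V := fterm_premodule E n d)).
  exact: subspaceZ (sS n d) _ _ IHx.
- move=> n d s x IHx; rewrite -(act_quotE (P := fterm_preoperad E)).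
  exact: Sact.
- exact: Sunit.
- move=> m n r e c d q f i a IHa b IHb.
  by rewrite -(comp_quotE (P := fterm_preoperad E)); apply: Scomp.
- exact: Sgen.
Qed.

(** * A multifiltration of the model *)

Section ModelFiltration.
Variable k : fieldType.
Local Open Scope classical_set_scope.

(** The reverse inclusion is the given one for the inverse permutation. *)
Lemma mf_act_of_sub (P : operad k) (F : multifamily P) :
  (forall n d p (s : 'S_n.+1) x, F n d p x -> F n d (midx_perm p s) (act s x)) ->
  forall n d p (s : 'S_n.+1),
    [set act s x | x in F n d p] = F n d (midx_perm p s).
Proof.
move=> sub n d p s; apply/seteqP; split=> [_ [x hx <-]|y hy]; first exact: sub.
exists (act s^-1%g y); last by rewrite act_act mulgV act_id.
suff -> : p = midx_perm (midx_perm p s) s^-1%g by apply: sub.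
by apply/ffunP => i; rewrite !ffunE permKV.
Qed.

(* "Order at most 1 in x_i": satisfied by the composites x(y(_,_),x_i) and by
   the commutators based at x_i. *)
Definition dual_cond (i : 'I_3) (u : model_car k) : Prop :=
  u (i + 1) *m flip k true + (u (i - 1))^T = 0.

(* "Order at most z in the i-th input"; arities above 3 carry no information. *)
Definition order_cond n : 'I_n.+1 -> int -> model_car k -> Prop :=
  match n with
  | 0%N => fun _ z u => z < 0 -> u = 0
  | 1%N => fun _ z u => z < 1 -> u = 0
  | 2%N => fun i z u => (z < 1 -> u = 0) /\ (z < 2 -> dual_cond i u)
  | _ => fun _ _ _ => True
  end.

Definition model_filtration : multifamily (model_operad k) :=
  fun n d p => [set u | forall i, order_cond i (p i) u].

Lemma dual_cond_subspace i : is_subspace (dual_cond i : set (model_car k)).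
Proof.
split=> [|c u v]; first by rewrite /dual_cond !ffunE mul0mx linear0 addr0.
rewrite /dual_cond !ffunE => hu hv; rewrite mulmxDl linearD linearZ /=.
by rewrite addrACA -scalemxAl -scalerDr hu hv scaler0 addr0.
Qed.

Lemma order_cond_subspace n (i : 'I_n.+1) z :
  is_subspace (order_cond i z : set (model_car k)).
Proof.
case: n i => [|[|[|n]]] i //=; split=> //.
- by move=> c u v hu hv le; rewrite hu // hv // scaler0 addr0.
- by move=> c u v hu hv le; rewrite hu // hv // scaler0 addr0.
- by split=> // _; apply: subspace0 (dual_cond_subspace i).
- move=> c u v [hu du] [hv dv]; split=> le.
    by rewrite hu // hv // scaler0 addr0.
  by case: (dual_cond_subspace i) => _; apply; [apply: du|apply: dv].
Qed.

Lemma order_cond0 n (i : 'I_n.+1) z : order_cond i z 0.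
Proof. exact: subspace0 (order_cond_subspace i z). Qed.

Lemma order_cond_mono n (i : 'I_n.+1) z z' u :
  z <= z' -> order_cond i z u -> order_cond i z' u.
Proof.
case: n i => [|[|[|n]]] i //= le.
- by move=> h lt; apply: h; apply: le_lt_trans lt.
- by move=> h lt; apply: h; apply: le_lt_trans lt.
- by move=> [h h'] ; split=> lt; [apply: h|apply: h']; apply: le_lt_trans lt.
Qed.

Lemma order_cond_large n (i : 'I_n.+1) z u : (2 < n)%N -> order_cond i z u.
Proof. by case: n i => [|[|[|n]]]. Qed.

Lemma dual_cond_act (s : 'S_3) i u :
  dual_cond (s i) u -> dual_cond i (@model_act_fun k 2 s u).
Proof.
rewrite /dual_cond !ffunE !(perm3E s (_ + _)) !mulrDr !addrA -(perm3E s i).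
case: (odd_perm s).
  rewrite expr1 mulr1 mulrNN mulr1 => h.
  rewrite -mulmxA flipM flip0 mulmx1 -[RHS]trmx0 -h linearD /= trmxK.
  exact: addrC.
by rewrite expr0 !mul1r flip0 !mulmx1.
Qed.

Lemma order_cond_act n (s : 'S_n.+1) i z u :
  order_cond (s i) z u -> order_cond i z (model_act_fun s u).
Proof.
case: n s i => [|[|[|n]]] s i //=.
- by move=> h /h ->; apply/ffunP => j; rewrite !ffunE mul0mx.
- move=> [h h']; split=> [/h ->|/h'].
    by apply/ffunP => j; rewrite !ffunE mul0mx.
  exact: dual_cond_act.
Qed.

Lemma model_filtration_unary n (a b : model_car k) c (p : midx 0) (p' q : midx n) d :
  model_filtration (d := d) p a -> model_filtration (d := c) p' b ->
  (0 <= p 0 -> midx_le p' q) ->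
  model_filtration (d := c) q (coef d a *: b).
Proof.
move=> ha hb le i; have [p0|p0] := ltP (p 0) 0.
  rewrite (ha 0 p0) coef0 scale0r; exact: order_cond0.
apply: subspaceZ (order_cond_subspace _ _) _ _ _.
by apply: order_cond_mono (hb i); apply: le.
Qed.

(** Unary elements are central in the model: where their [coef] is nonzero the degree is 0, and the
    Koszul sign is 1. *)
Lemma model_commutator_unary m n r (e : (m + n)%N = r) c d q (f : c + d = q)
    (i : 'I_m.+1) (j : 'I_n.+1) (a : model_operad k m c) (b : model_operad k n d) :
  (m == 0)%N || (n == 0)%N -> op_commutator e f i j a b = 0.
Proof.
move=> mn0; rewrite /op_commutator.
have im : (i <= m)%N by rewrite -ltnS.
have jn : (j <= n)%N by rewrite -ltnS.
rewrite !nat_perm_id ?act_id; first last.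
- by move=> l le; rewrite /block_swap; do !case: ifP; lia.
- by move=> l le; rewrite /block_swap; do !case: ifP; lia.
apply/eqP; rewrite subr_eq0; apply/eqP; rewrite /=.
case: m n i j mn0 a b {e im jn} => [|m] [|n] // i j _ a b.
- rewrite (model_comp_funC _ _ i j).
  have [a0|/coef_neq0 ->] := eqVneq (coef c a) 0; last first.
    by rewrite mul0r expr0z scale1r.
  have [b0|/coef_neq0 ->] := eqVneq (coef d b) 0; last first.
    by rewrite mulr0 expr0z scale1r.
  by rewrite model_comp00 a0 b0 mul0r !scale0r subr0 addr0 scaler0.
- rewrite model_comp0S model_compS0.
  have [->|/coef_neq0 ->] := eqVneq (coef c a) 0; first by rewrite scale0r scaler0.
  by rewrite mul0r expr0z scale1r.
- rewrite model_comp0S model_compS0.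
  have [->|/coef_neq0 ->] := eqVneq (coef d b) 0; first by rewrite scale0r scaler0.
  by rewrite mulr0 expr0z scale1r.
Qed.

Lemma model_comp2_order (i : 'I_2) (a b : model_car k) z l :
  1 <= z -> (l != outer_input i -> 2 <= z) -> order_cond l z (model_comp2 i a b).
Proof.
move=> z1 z2; split=> lt; first by move: z1; rewrite leNgt lt.
have /eqP -> : l == outer_input i by apply: contraTT lt => /z2; rewrite -leNgt.
have n1 : (outer_input i + 1 == outer_input i) = false by elim/ord2P: i {z2}.
have n2 : (outer_input i - 1 == outer_input i) = false by elim/ord2P: i {n1 z2}.
by rewrite /dual_cond !ffunE n1 n2 mul0mx linear0 addr0.
Qed.

Lemma block_swap3 u v : (u < 2)%N -> (v < 2)%N ->
  (nat_perm 2 (block_swap 0 u v) = affine ((u == 1%N) && (v == 1%N)) ((u == 1%N) && (v == 1%N))%:R) *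
  (nat_perm 2 (block_swap (u + v).+1 (1 - u) (1 - v)) =
     affine ((u == 0%N) && (v == 0%N)) 0).
Proof.
move=> hu hv; split; apply: perm3_eq; apply: val_inj;
  rewrite /= block_swapE; try lia;
  by case: u v hu hv => [|[|]] [|[|]].
Qed.

(** This is the origin of [dual_cond]. The two terms of the commutator occupy the two blocks whose
    outer variable is not the base variable i + j, and their matrices are outer products of the same
    two coordinate pairs in opposite orders, so that transposition matches them up to flips. *)
Lemma model_commutator_binary (i j : 'I_2) (a b : model_car k) :
  dual_cond (inord (i + j))
    (@model_act_fun k 2 (nat_perm 2 (block_swap 0 i j)) (model_comp2 i a b) -
     @model_act_fun k 2 (nat_perm 2 (block_swap (i + j).+1 (1 - i) (1 - j)))
       (model_comp2 j b a)).
Proof.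

have inord3 : (inord 0 = 0 :> 'I_3) * (inord 1 = 1 :> 'I_3) * (inord 2 = -1 :> 'I_3).
  by do !split; apply: val_inj; rewrite /= inordK.
have trN (A : 'M[k]_2) : (- A)^T = - A^T by exact: linearN.
rewrite !block_swap3 //; elim/ord2P: i; elim/ord2P: j => /=;
  rewrite /addn /= !inord3 /dual_cond !ffunE !affineE !odd_affine /=;
  (* Evaluates the closed equalities in Z/3 that decide which blocks are zero. *)
  repeat match goal with |- context [?x == ?y :> 'I_3] =>
    let c := eval vm_compute in (x == y :> 'I_3) in
    change (x == y :> 'I_3) with c end;
  rewrite /= ?flip0 !(mulmx1, mul0mx, sub0r, subr0, mulNmx, trN)
    !trmx_mul !trmxK ?tr_flip.
- by rewrite -mulmxA flipM flip0 mulmx1 addNr.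
- by rewrite mulmxA subrr.
- by rewrite mulmxA addNr.
- by rewrite !mulmxA addNr.
Qed.

End ModelFiltration.

Section ModelDFiltration.
Variable k : fieldType.
Local Open Scope classical_set_scope.
#[local] Arguments model_comp_fun : simpl never.

Lemma model_compE m n r (e : (m + n)%N = r) c d q (f : c + d = q) (i : 'I_m.+1)
    (a : model_operad k m c) (b : model_operad k n d) :
  comp e f i a b = model_comp_fun m n c d i a b.
Proof. by []. Qed.

Lemma model_filtration_comp m n r (e : (m + n)%N = r) c d q (f : c + d = q)
    (i : 'I_m.+1) (p : midx m) (p' : midx n) (a : model_operad k m c)
    (b : model_operad k n d) :
  model_filtration p a -> model_filtration p' b ->
  model_filtration (midx_comp r i p p') (comp e f i a b).
Proof.
rewrite model_compE; case: m n e i p p' a b => [|m] [|n] e i p p' a b ha hb.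
- case: r / e; move=> l.
  rewrite (ord1 l) (ord1 i) ffunE /= => {l} lt.
  have [p0|p0] := ltP (p 0) 0; first by rewrite (ha 0 p0) model_comp_0l.
  have [p0'|p0'] := ltP (p' 0) 0; first by rewrite (hb 0 p0') model_comp_0r.
  move: lt; rewrite (_ : inord 0 = 0); last by apply: val_inj; rewrite /= inordK.
  lia.
- case: r / e; rewrite model_comp0S.
  apply: (model_filtration_unary ha hb) => p0 l.
  rewrite !ffunE (ord1 i) /= subn0 inord_val.
  case: ifP => [_|/negP[]]; first by rewrite lerDl.
  exact: (ltn_ord l).
- have {}e : m.+1 = r by rewrite -e addn0.
  case: r / e; rewrite model_compS0.
  apply: (model_filtration_unary hb ha) => p0 l.
  rewrite !ffunE addn0 subn0 inord_val (ord1 (inord _)).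
  case: ltngtP => // li; rewrite (ord_inj li) lerDr; exact: p0.
- move=> l; case: m n e i p p' a b ha hb => [|m] [|n] e i p p' a b ha hb;
    try by apply: order_cond_large; lia.
  case: r / e l => l; rewrite model_comp11 inord_val.
  case: ifP => _; last exact: order_cond0.
  (* A binary element with some order below 1 is zero. So all orders may be assumed at least 1, and
     an input that receives a sum of two orders gets at least 2, where [dual_cond] is not
     imposed. *)
  have [pi|pi] := boolP [forall j, 1 <= p j]; last first.
    move: pi; rewrite negb_forall => /existsP [j]; rewrite -ltNge => /(ha j) ->.
    by rewrite model_comp2_0l; apply: order_cond0.
  have [pi'|pi'] := boolP [forall j, 1 <= p' j]; last first.
    move: pi'; rewrite negb_forall => /existsP [j]; rewrite -ltNge => /(hb j) ->.
    by rewrite model_comp2_0r; apply: order_cond0.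
  move: pi pi' => /forallP pi /forallP pi'.
  apply: model_comp2_order; rewrite !ffunE.
    by do !case: ifP => _; rewrite ?pi // (le_trans (pi i)) // lerDr (le_trans _ (pi' _)).
  have pp u v : 2 <= p' u + p v by have := pi v; have := pi' u; lia.
  by move: l; elim/ord2P: i; elim/ord3P => /=.
Qed.

Lemma model_filtration_commutator m n r (e : (m + n)%N = r) c d q (f : c + d = q)
    (i : 'I_m.+1) (j : 'I_n.+1) (p : midx m) (p' : midx n)
    (a : model_operad k m c) (b : model_operad k n d) :
  model_filtration p a -> model_filtration p' b ->
  model_filtration (midx_bracket r i j p p') (op_commutator e f i j a b).
Proof.
move=> ha hb l.
have [mn0|mn0] := boolP ((m == 0)%N || (n == 0)%N).
  by rewrite model_commutator_unary //; apply: order_cond0.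
case: m n e i j p p' a b ha hb mn0 => [|[|m]] [|[|n]] // e i j p p' a b ha hb _;
  try by apply: order_cond_large; lia.
case: r / e l => l; rewrite /op_commutator !model_compE !model_comp11.
rewrite [(d == 0) && _]andbC.
case: ifP => [/andP[/eqP c0 _]|_]; last first.
  by rewrite !act0 scaler0 subr0; apply: order_cond0.
rewrite c0 mul0r expr0z scale1r !inord_val.
have [pi|pi] := boolP [forall j, 1 <= p j]; last first.
  move: pi; rewrite negb_forall => /existsP [v]; rewrite -ltNge => /(ha v) ->.
  by rewrite model_comp2_0l model_comp2_0r !act0 subr0; apply: order_cond0.
have [pi'|pi'] := boolP [forall j, 1 <= p' j]; last first.
  move: pi'; rewrite negb_forall => /existsP [v]; rewrite -ltNge => /(hb v) ->.
  by rewrite model_comp2_0l model_comp2_0r !act0 subr0; apply: order_cond0.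
move: pi pi' => /forallP pi /forallP pi'.
have pp u v : 2 <= p' u + p v by have := pi v; have := pi' u; lia.
rewrite ffunE; split.
  rewrite ltNge => /negP []; have := pp j i.
  by do !case: ifP => _; have := pp (inord l) i; have := pp j (inord (l - j));
    have := pp (inord (l - i)) i; have := pp j (inord (l - 1)); lia.
(* Only at the base input does the shift by -1 allow the order 1, so only there does the commutator
   need [dual_cond]. *)
have [lij|ne] := eqVneq (l : nat) (i + j)%N.
  have -> : l = inord (i + j) by rewrite -lij inord_val.
  by move=> _; apply: model_commutator_binary.
rewrite ltNge => /negP []; by case: eqP ne => // _ _; do !case: ifP => _; rewrite // addrC.
Qed.

Theorem model_filtration_D : is_D_multifiltration (@model_filtration k).
Proof.
split; last exact: model_filtration_commutator.
split; last 1 first.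
- move=> i; have := ord1 i => -> /=; rewrite ffunE; lia.
- move=> n d p; split=> [i|c u v hu hv i]; first exact: order_cond0.
  case: (order_cond_subspace k i (p i)) => _; apply; [exact: hu|exact: hv].
- move=> n d p p' le u hu i; exact: order_cond_mono (le i) (hu i).
- apply: mf_act_of_sub => n d p s u hu i; rewrite ffunE; exact: order_cond_act.
- exact: model_filtration_comp.
Qed.

Lemma model_filtration_saturated : is_saturated (@model_filtration k).
Proof.
move=> n d p p'; apply/seteqP; split=> [u [hu hu'] i|u hu].
  by rewrite ffunE; case: leP.
by split=> i; have := hu i; apply: order_cond_mono; rewrite ffunE ge_min lexx ?orbT.
Qed.

End ModelDFiltration.

(** * Pullback of multifiltrations along operad morphisms *)

Section Pullback.
Local Open Scope classical_set_scope.
Variables (k : fieldType) (P Q : operad k) (h : op_hom P Q) (F : multifamily Q).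

Definition pullback : multifamily P := fun n d p => [set x | F p (h n d x)].

Lemma op_hom_commutator m n r (e : (m + n)%N = r) c d q (f : c + d = q)
    (i : 'I_m.+1) (j : 'I_n.+1) (a : P m c) (b : P n d) :
  h r q (op_commutator e f i j a b) =
  op_commutator e f i j (h m c a) (h n d b).
Proof.
by rewrite /op_commutator col_homD -scaleN1r !col_homZ !col_hom_act !op_hom_comp
  scaleN1r.
Qed.

Lemma pullback_D : is_D_multifiltration F -> is_D_multifiltration pullback.
Proof.
move=> [Fm Fc]; split; last first.
  move=> m n r e c d q f i j p p' a b ha hb.
  by rewrite /pullback /mkset op_hom_commutator; apply: Fc.
split.
- move=> n d p; split=> [|c x y hx hy]; rewrite /pullback /mkset.
    by rewrite col_hom0; apply: subspace0 (mf_subspace Fm d p).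
  by rewrite col_hom_linear; case: (mf_subspace Fm d p) => _; apply.
- by move=> n d p p' le x; apply: (mf_mono Fm).
- apply: mf_act_of_sub => n d p s x hx; rewrite /pullback /mkset col_hom_act.
  by rewrite -(mf_act Fm); exists (h n d x).
- move=> m n r e c d q f i p p' a b ha hb.
  by rewrite /pullback /mkset op_hom_comp; apply: (mf_comp Fm).
- by rewrite /pullback /mkset op_hom_unit; apply: (mf_unit Fm).
Qed.

Lemma pullback_saturated : is_saturated F -> is_saturated pullback.
Proof.
move=> Fs n d p p'; apply/seteqP; split=> x; rewrite /pullback /mkset -Fs.
  by case.
by [].
Qed.

End Pullback.

(** * Jacobiators *)

Section Jacobiator.
Variables (k : fieldType) (P : operad k).
Implicit Types (x y : P 2%N 0) (a b : P 1%N 0).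

Lemma comp_compose2 (e : (1 + 1)%N = 2%N) (f : 0 + 0 = 0 :> int) i a b :
  comp e f i a b = compose2 i a b.
Proof.
by rewrite /compose2 (Prop_irrelevance e erefl) (Prop_irrelevance f (add0r 0)).
Qed.

Lemma compose2_act i a b (s t : 'S_2) :
  compose2 i (act s a) (act t b) = act (perm_comp 2 s i t) (compose2 (s i) a b).
Proof. exact: comp_act. Qed.

Lemma compose2_actr a b :
  compose2 0 a (act swap2 b) = act (affine true 1) (compose2 0 a b).
Proof.
rewrite -{1}[a]act_id compose2_act perm_comp_binary perm1 odd_swap2.
by congr (act (affine _ _) _); apply: val_inj.
Qed.

(** Turning the outer operation brings the inner one into its first slot, at the price of a
    rotation. This reduces all composites to those at input 0. *)
Lemma compose2_1 a b :
  compose2 1 a b = act (affine false (-1)) (compose2 0 (act swap2 a) b).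
Proof.
have aE : act swap2 (act swap2 a) = a by rewrite act_act swap2K act_id.
rewrite -{1}aE -{1}[b]act_id compose2_act perm_comp_binary tpermR odd_perm1.
by congr (act (affine _ _) _); apply: val_inj.
Qed.

Definition cyclic_sum x : P 2%N 0 := \sum_z act (affine false z) x.

Lemma cyclic_sum_rot w x : cyclic_sum (act (affine false w) x) = cyclic_sum x.
Proof.
rewrite /cyclic_sum (reindex_inj (addrI (- w))) /=; apply: eq_bigr => z _.
by rewrite act_act affineM expr0 mul1r addNKr.
Qed.

Lemma act_cyclic_sum w x : act (affine false w) (cyclic_sum x) = cyclic_sum x.
Proof.
rewrite -{2}(cyclic_sum_rot w) /cyclic_sum act_sum; apply: eq_bigr => z _.
by rewrite !act_act !affineM !expr0 !mul1r addrC.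
Qed.

Lemma cyclic_sumD x y : cyclic_sum (x + y) = cyclic_sum x + cyclic_sum y.
Proof. by rewrite -big_split; apply: eq_bigr => z _; rewrite actD. Qed.

Lemma cyclic_sumZ c x : cyclic_sum (c *: x) = c *: cyclic_sum x.
Proof. by rewrite scaler_sumr; apply: eq_bigr => z _; rewrite actZ. Qed.

Lemma cyclic_sumE x :
  cyclic_sum x = x + act (affine false 1) x + act (affine false (-1)) x.
Proof.
rewrite /cyclic_sum !big_ord_recl big_ord0 addr0 addrA.
rewrite -[X in _ = X + _ + _]act_id -affine0.
by congr (_ + _ + _); congr (act (affine _ _) _); apply: val_inj.
Qed.

Definition jacobiator b : P 2%N 0 := cyclic_sum (compose2 0 b b).

(** The alternating sum is a cyclic sum antisymmetrised under the transposition of 0 and 1. That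
    antisymmetrisation makes the inner product a commutator, while the two bracketings of the
    associator, equal up to rotation and a swap, make the outer one a commutator. *)
Lemma alternating_associator b :
  \sum_(s : 'S_3) (-1) ^+ s *:
    relabel s (compose2 0 b b - compose2 1 b b) =
  jacobiator (b - act swap2 b).
Proof.
have altE x : \sum_(s : 'S_3) (-1) ^+ s *: relabel s x =
    cyclic_sum (x - act (affine true 1) x).
  rewrite (reindex_inj invg_inj) /= sum_perm3 big_bool /= addrC -scaleN1r.
  rewrite cyclic_sumD cyclic_sumZ scaler_sumr; congr (_ + _).
    by apply: eq_bigr => z _; rewrite odd_permV odd_affine /relabel invgK scale1r.
  (* Translation by z times the reflection j -> 1 - j is the reflection with value 1 - z at 0. *)
  rewrite [RHS](reindex_inj (inj_comp (addrI 1) oppr_inj)) /=.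
  apply: eq_bigr => z _; rewrite odd_permV odd_affine /relabel invgK expr1.
  by rewrite act_act affineM expr1 mulN1r subKr.
have cyclic_sumB x y : cyclic_sum (x - y) = cyclic_sum x - cyclic_sum y.
  by rewrite cyclic_sumD -scaleN1r cyclic_sumZ scaleN1r.
rewrite /jacobiator.
have -> : compose2 0 (b - act swap2 b) (b - act swap2 b) =
    compose2 0 (b - act swap2 b) b -
    act (affine true 1) (compose2 0 (b - act swap2 b) b).
  by rewrite -compose2_actr {1}/compose2 compDr compNr.
have -> : compose2 0 (b - act swap2 b) b =
    compose2 0 b b - compose2 0 (act swap2 b) b.
  by rewrite /compose2 compDl compNl.
rewrite altE compose2_1 actD actN.
have -> : act (affine true 1) (act (affine false (-1)) (compose2 0 (act swap2 b) b)) =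
    act (affine false 1) (act (affine true 1) (compose2 0 (act swap2 b) b)).
  by rewrite !act_act !affineM; congr (act (affine _ _) _); apply: val_inj.
by rewrite !(actD, actN, cyclic_sumB, cyclic_sum_rot).
Qed.

(** The Jacobi identity has its inner bracket in the second slot. Moving it to the first costs the
    sign, and the accompanying rotation disappears in the cyclic sum. *)
Lemma jacobi_jacobiator b : act swap2 b = - b ->
  let J := compose2 (inord 1) b b in
  J + relabel (nat_perm 2 (nth 0%N [:: 1; 2; 0]%N)) J
    + relabel (nat_perm 2 (nth 0%N [:: 2; 0; 1]%N)) J = - jacobiator b.
Proof.
move=> anti J.
have rotE w z : nat_perm 2 (nth 0%N w) = affine false z ->
    relabel (nat_perm 2 (nth 0%N w)) J = act (affine false (- z)) J.
  move=> ->; rewrite /relabel; congr (act _ _); apply: (mulgI (affine false z)).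
  by rewrite mulgV affineM expr0 mul1r addNr affine0.
rewrite (rotE _ 1) ?(rotE _ (-1)); first last.
- by apply: perm3_eq; apply: val_inj; rewrite /= nat_permE // => [[|[|[|i]]]
    | [|[|[|i]]] [|[|[|j]]]].
- by apply: perm3_eq; apply: val_inj; rewrite /= nat_permE // => [[|[|[|i]]]
    | [|[|[|i]]] [|[|[|j]]]].
rewrite opprK addrAC -cyclic_sumE /J inord2 compose2_1 cyclic_sum_rot anti.
by rewrite /compose2 compNl -scaleN1r cyclic_sumZ scaleN1r.
Qed.

Section Filtration.
Local Open Scope classical_set_scope.
Variable F : multifamily P.
Hypotheses (F_D : is_D_multifiltration F) (F_sat : is_saturated F).

(* The Jacobiator of an antisymmetric b is the sum of the composite
   b(b(x_1,x_2),x_0) and of a commutator of b with itself, both of order 1 in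
   x_0; by cyclic symmetry and saturation it is of order 1 in every input. *)
Lemma jacobiator_filtration b :
  act swap2 b = - b -> F (midx_const 1 1) b -> F (midx_const 2 1) (jacobiator b).
Proof.
have [Fm Fc] := F_D.
move=> anti Fb; pose q w : midx 2 := [ffun l => if l == w then 1 else 2].
suff Fq w : F (q w) (jacobiator b).
  have : F (midx_meet (q 0) (midx_meet (q 1) (q (-1)))) (jacobiator b).
    by rewrite -!F_sat.
  by apply: (mf_mono Fm); elim/ord3P; rewrite !ffunE.
suff {w} F0 : F (q 0) (jacobiator b).
  rewrite /jacobiator -(act_cyclic_sum (- w)).
  suff -> : q w = midx_perm (q 0) (affine false (- w)).
    by rewrite -(mf_act Fm); exists (jacobiator b).
  by apply/ffunP => l; rewrite !ffunE affineE expr0 mul1r addrC subr_eq0.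
set X := compose2 0 b b.
have antiX : act (affine true 1) X = - X.
  by rewrite -compose2_actr anti /X /compose2 compNr.
have -> : jacobiator b =
    op_commutator (erefl : (1 + 1)%N = 2%N) (add0r 0) 0 0 b b +
    act (affine false (-1)) X.
  rewrite /jacobiator cyclic_sumE; congr (_ + _).
  rewrite /op_commutator mulr0 expr0z scale1r.
  rewrite !(block_swap3 (isT : (0 < 2)%N) (isT : (0 < 2)%N)).
  rewrite affine0 act_id -/X; congr (_ + _).
  have -> : act (affine false 1) X = - act (affine false 1) (act (affine true 1) X).
    by rewrite antiX actN opprK.
  rewrite act_act affineM; congr (- _).
  by rewrite comp_compose2; congr (act (affine _ _) _); apply: val_inj.
apply: (subspaceD (mf_subspace Fm 0 (q 0))).
  apply: (mf_mono Fm) (Fc _ _ _ _ _ _ _ _ _ _ _ _ _ _ Fb Fb).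
  by elim/ord3P; rewrite !ffunE.
have : F (midx_comp 2 0 (midx_const 1 1) (midx_const 1 1)) X by apply: (mf_comp Fm).
move=> FX.
have : F (midx_perm (midx_comp 2 0 (midx_const 1 1) (midx_const 1 1))
    (affine false (-1))) (act (affine false (-1)) X).
  by rewrite -(mf_act Fm); exists X.
by apply: (mf_mono Fm); elim/ord3P; rewrite !ffunE affineE.
Qed.
End Filtration.

End Jacobiator.

(** * Free operads on one binary operation *)

Section BinaryHom.
Variables (k : fieldType) (E F : collection k) (h : E 1%N 0 -> F 1%N 0).
Hypotheses (h_linear : forall c x y, h (c *: x + y) = c *: h x + h y)
  (h_act : forall (s : 'S_2) x, h (act s x) = act s (h x)).

Definition binary_fun n d : E n d -> F n d :=
  match n, d with
  | 1%N, Posz 0 => h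
  | _, _ => fun _ => 0
  end.

Definition binary_hom : col_hom E F.
Proof.
by refine (@ColHom k E F binary_fun _ _) => -[|[|n]] [[|d]|d] //= *;
  rewrite ?scaler0 ?addr0 ?act0.
Defined.

End BinaryHom.

Section LineCoordinate.
Variables (k : fieldType) (V : lmodType k).

(** The value 0 for w = 0 allows a uniform treatment of symmetric, antisymmetric and general
    operations. *)
Definition line_coord (w v : V) : k :=
  if w == 0 then 0 else xget 0 [set c | v = c *: w]%classic.

Lemma line_coordZ w c : line_coord w (c *: w) = if w == 0 then 0 else c.
Proof.
rewrite /line_coord; case: eqP => // /eqP w0.
case: xgetP => [c' _ /= /eqP|/(_ c) [] //].
by rewrite -subr_eq0 -scalerBl scaler_eq0 (negPf w0) orbF subr_eq0 => /eqP ->.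
Qed.

End LineCoordinate.

Section SingleBinary.
Variables (k : fieldType) (two_neq0 : 2%:R != 0 :> k) (E : collection k).
Hypothesis E0 : forall n d (x : E n d), n <> 1%N \/ d <> 0 -> x = 0.
Variable mu : E 1%N 0.
Hypothesis mu_gen :
  forall x, exists c : 'S_2 -> k, x = \sum_(s : 'S_2) c s *: act s mu.

(** Without the factor 1/2 the antisymmetric part of a product is its commutator. Either part may
    vanish. *)
Definition sym_part : E 1%N 0 := mu + act swap2 mu.
Definition asym_part : E 1%N 0 := mu - act swap2 mu.

Lemma act_sym_part : act swap2 sym_part = sym_part.
Proof. by rewrite actD act_act swap2K act_id addrC. Qed.

Lemma act_asym_part : act swap2 asym_part = - asym_part.
Proof. by rewrite actD actN act_act swap2K act_id opprB. Qed.

Lemma sym_asym_span x : exists a b, x = a *: sym_part + b *: asym_part.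
Proof.
have [c ->] := mu_gen x; rewrite sum_perm2 act_id.
exists (2%:R^-1 * (c 1%g + c swap2)), (2%:R^-1 * (c 1%g - c swap2)).
rewrite /sym_part /asym_part !scalerDr !scalerN addrACA -scalerDl -scalerBl.
by congr (_ *: _ + _ *: _); field.
Qed.

Definition sym_coord (x : E 1%N 0) : k :=
  line_coord sym_part (2%:R^-1 *: (x + act swap2 x)).
Definition asym_coord (x : E 1%N 0) : k :=
  line_coord asym_part (2%:R^-1 *: (x - act swap2 x)).

Lemma coordE a b :
  (sym_coord (a *: sym_part + b *: asym_part) =
     if sym_part == 0 then 0 else a) *
  (asym_coord (a *: sym_part + b *: asym_part) =
     if asym_part == 0 then 0 else b).
Proof.
rewrite /sym_coord /asym_coord actD !actZ act_sym_part act_asym_part.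
have half (y : E 1%N 0) : 2%:R^-1 *: (y + y) = y.
  by rewrite -mulr2n -scaler_nat scalerA mulVf // scale1r.
rewrite scalerN addrACA subrr addr0 half opprD opprK addrACA subrr add0r half.
by rewrite !line_coordZ.
Qed.

Lemma coordK x : x = sym_coord x *: sym_part + asym_coord x *: asym_part.
Proof.
have [a [b ->]] := sym_asym_span x; rewrite !coordE.
by congr (_ + _); case: ifP => // /eqP ->; rewrite !scaler0.
Qed.

Definition coords x : 'rV[k]_2 :=
  \row_j if j == 0 then sym_coord x else asym_coord x.

Fact coords_linear c x y : coords (c *: x + y) = c *: coords x + coords y.
Proof.
have [a [b ->]] := sym_asym_span x; have [a' [b' ->]] := sym_asym_span y.
have -> : c *: (a *: sym_part + b *: asym_part) +
    (a' *: sym_part + b' *: asym_part) =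
    (c * a + a') *: sym_part + (c * b + b') *: asym_part.
  by rewrite scalerDr !scalerA addrACA -!scalerDl.
apply/rowP => j; rewrite !mxE !coordE.
by case: (j == 0); case: ifP; rewrite // mulr0 addr0.
Qed.

Fact coords_act (s : 'S_2) x : coords (act s x) = coords x *m flip k s.
Proof.
elim/perm2P: s; first by rewrite act_id odd_perm1 flip0 mulmx1.
have [a [b ->]] := sym_asym_span x.
rewrite actD !actZ act_sym_part act_asym_part odd_swap2.
apply/rowP => j; rewrite mul_flipE scalerN -scaleNr !mxE !coordE.
elim/ord2P: j; rewrite /= ?expr0 ?mul1r // expr1.
by case: ifP; rewrite ?mulr0 // mulN1r.
Qed.

(** Composition of binary elements reads them only through [pair_of]; the copies in the other row
    and blocks are harmless. *)
Definition gen_model (x : E 1%N 0) : model_operad k 1%N 0 :=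
  [ffun=> const_mx 1 *m coords x].

Lemma pair_of_gen_model x : pair_of (gen_model x) = coords x.
Proof.
by rewrite /pair_of ffunE; apply/rowP => j; rewrite !mxE big_ord1 !mxE mul1r.
Qed.

Definition model_gens : col_hom E (model_operad k).
Proof.
apply: (@binary_hom k E (model_operad k) gen_model).
- move=> c x y; apply/ffunP => z.
  by rewrite !ffunE coords_linear mulmxDr scalemxAr.
- by move=> s x; apply/ffunP => z; rewrite !ffunE coords_act mulmxA.
Defined.

Definition to_model : op_hom (free_operad E) (model_operad k) :=
  free_lift model_gens.

Local Notation gen := (free_gen E 1%N 0).

Definition basis_gen (j : 'I_2) : free_operad E 1%N 0 :=
  gen (if j == 0 then sym_part else asym_part).

Lemma genE x : gen x = \sum_j coords x 0 j *: basis_gen j.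
Proof.
rewrite {1}[x]coordK col_homD !col_homZ big_ord_recl big_ord1 !mxE /=.
by [].
Qed.

Definition block_element (A : 'M[k]_2) : free_operad E 2%N 0 :=
  \sum_i \sum_j A i j *: compose2 0 (basis_gen i) (basis_gen j).

Lemma basis_gen_act j :
  act swap2 (basis_gen j) = (-1) ^+ (j == 1) *: basis_gen j.
Proof.
rewrite /basis_gen -col_hom_act; elim/ord2P: j.
  by rewrite eqxx act_sym_part scale1r.
rewrite (_ : (1 == 0 :> 'I_2) = false) // eqxx expr1.
by rewrite act_asym_part -[- asym_part]scaleN1r col_homZ.
Qed.

Lemma block_element_flip A :
  block_element (A *m flip k true) = act (affine true 1) (block_element A).
Proof.
rewrite /block_element act_sum; apply: eq_bigr => i _.
rewrite act_sum; apply: eq_bigr => j _.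
by rewrite actZ -compose2_actr basis_gen_act /compose2 compZr scalerA
  mul_flipE mulrC.
Qed.

Lemma block_element_gen x y :
  block_element ((coords x)^T *m coords y) = compose2 0 (gen x) (gen y).
Proof.
rewrite !genE /block_element.
have sumE (G : 'I_2 -> free_operad E 2%N 0) : \sum_i G i = G 0 + G 1.
  rewrite big_ord_recl big_ord1; congr (_ + G _); exact: val_inj.
have sumE' (G : 'I_2 -> free_operad E 1%N 0) : \sum_i G i = G 0 + G 1.
  rewrite big_ord_recl big_ord1; congr (_ + G _); exact: val_inj.
rewrite !(sumE, sumE') /compose2 !(compDl, compDr, compZl, compZr) !scalerA.
by rewrite !mxE !big_ord1 !mxE.
Qed.

(* A left inverse of [to_model] in arity 3, even when [sym_part] or [asym_part]
   vanishes: the coordinates on a vanishing generator are 0. *)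
Definition from_model (u : model_car k) : free_operad E 2%N 0 :=
  \sum_z act (affine false (-1 - z)) (block_element (u z)).

Lemma from_model_linear c u v :
  from_model (c *: u + v) = c *: from_model u + from_model v.
Proof.
rewrite /from_model scaler_sumr -big_split /=; apply: eq_bigr => z _.
apply: etrans (act_linear _ c (block_element (u z)) (block_element (v z))).
congr (act _ _); rewrite scaler_sumr -big_split; apply: eq_bigr => i _ /=.
rewrite scaler_sumr -big_split; apply: eq_bigr => j _ /=.
by rewrite !ffunE !mxE scalerA scalerDl.
Qed.

Lemma from_model_act (s : 'S_3) u :
  from_model (@model_act_fun k 2 s u) = act s (from_model u).
Proof.
rewrite /from_model act_sum [RHS](reindex_inj (@perm_inj _ s)).
apply: eq_bigr => z _; rewrite ffunE (perm3E s z) act_act.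
rewrite [X in (X * _)%g]perm3P affineM expr0 mul1r.
have -> : -1 - (s 0 + (-1) ^+ s * z) + s 0 = -1 - (-1) ^+ s * z :> 'I_3.
  by rewrite opprD addrA addrAC subrK.
rewrite addbF; case: (odd_perm s).
  rewrite block_element_flip act_act affineM.
  congr (act (affine _ _) _).
  by elim/ord3P: z; apply: val_inj.
by rewrite flip0 mulmx1 expr0 mul1r.
Qed.

Lemma from_to_model_compose2 x y :
  from_model (to_model 2%N 0 (compose2 0 (gen x) (gen y))) =
  compose2 0 (gen x) (gen y).
Proof.
have -> : to_model 2%N 0 (compose2 0 (gen x) (gen y)) =
    model_comp2 0 (gen_model x) (gen_model y).
  rewrite op_hom_comp !free_lift_gen model_compE model_comp11 eqxx.
  by rewrite inord2.
(* A composite at input 0 has outer input -1, and for that block the rotation in [from_model] is the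
   identity. *)
rewrite /from_model (bigD1 (-1)) // big1 => [|z /andP[_ zN]].
  rewrite ffunE eqxx !pair_of_gen_model flip0 mulmx1 block_element_gen.
  by rewrite subrr affine0 act_id; apply: addr0.
rewrite ffunE (negPf zN) /block_element big1 ?act0 // => i _.
by rewrite big1 // => j _; rewrite mxE scale0r.
Qed.

(** Generators vanish outside arity 2 and degree 0, and a composite at input 1 is a rotated
    composite at input 0, so a single shape remains. *)
Lemma two_generators_ind (S : forall n d, free_operad E n d -> Prop) :
  (forall n d, S n d 0) ->
  (forall (s : 'S_3) x y, S 2%N 0 (act s (compose2 0 (gen x) (gen y)))) ->
  forall n d x, two_generators E n d x -> S n d x.
Proof.
move=> S0 S2 r q _ [m [n [e [c [d [f [i [a [b [s ->]]]]]]]]]].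
have zero l z (x : E l z) : (l = 1%N /\ z = 0) \/ x = 0.
  have [l1|/eqP ln] := eqVneq l 1%N; last by right; apply: E0; left.
  have [z0|/eqP zn] := eqVneq z 0; last by right; apply: E0; right.
  by left.
have [[m1 c0]|->] := zero m c a; last by rewrite col_hom0 comp_0l act0.
have [[n1 d0]|->] := zero n d b; last by rewrite col_hom0 comp_0r act0.
move: e f i a b s; rewrite m1 n1 c0 d0 => e f i a b s.
have r2 : 2%N = r by rewrite -e.
have q0 : 0 = q by rewrite -f addr0.
case: r / r2 e s => e s; case: q / q0 f => f.
rewrite comp_compose2; elim/ord2P: i; first exact: S2.
by rewrite compose2_1 -col_hom_act act_act; apply: S2.
Qed.

Lemma from_to_model_span x :
  lin_span (two_generators E 2%N 0) x -> from_model (to_model 2%N 0 x) = x.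
Proof.
pose S n d : free_operad E n d -> Prop :=
  match n, d with
  | 2%N, Posz 0 => fun x => from_model (to_model 2%N 0 x) = x
  | _, _ => fun _ => True
  end.
have SE y : S 2%N 0 y = (from_model (to_model 2%N 0 y) = y) by [].
have from_model0 : from_model 0 = 0.
  by have := from_model_linear (-1) 0 0; rewrite !scaleN1r !addNr.
apply: (@lin_span_sub _ _ _ (S 2%N 0)) => [|y].
  split=> [|c y z hy hz]; first by rewrite SE col_hom0.
  by rewrite SE col_hom_linear from_model_linear hy hz.
apply: two_generators_ind => [n d|s a b].
  by case: n => [|[|[|n]]] //; case: d => [[|d]|d] //; rewrite SE col_hom0.
rewrite SE col_hom_act; apply: etrans (from_model_act s _) _.
by rewrite from_to_model_compose2.
Qed.

(** A binary expression of arity 1, 2 or 3 contains no, one or two generators. Nothing is claimed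
    above arity 3, which makes closure under composition a finite check. *)
Definition low_arity_span n d : set (free_operad E n d) :=
  match n, d return set (free_operad E n d) with
  | 0%N, Posz 0 => [set x | exists c, x = c *: op_unit (free_operad E)]%classic
  | 0%N, _ => [set 0]%classic
  | 1%N, d => [set x | exists y, x = free_gen E 1%N d y]%classic
  | 2%N, d => lin_span (two_generators E 2%N d)
  | _, _ => setT
  end.

Lemma low_arity_span_subspace n d : is_subspace (@low_arity_span n d).
Proof.
case: n d => [|[|[|n]]] // d; last exact: lin_span_subspace.
- case: d => [[|d]|d] /=; try by split=> [//|c x y -> ->]; rewrite scaler0 addr0.
  split=> [|c _ _ [a ->] [b ->]]; first by exists 0; rewrite scale0r.
  by exists (c * a + b); rewrite scalerDl scalerA.
- split=> [|c _ _ [x ->] [y ->]]; first by exists 0; rewrite col_hom0.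
  by exists (c *: x + y); rewrite col_hom_linear.
Qed.

Lemma low_arity_span0 n d : @low_arity_span n d 0.
Proof. exact: subspace0 (low_arity_span_subspace n d). Qed.

Lemma comp_low_arity_l (S : subcollection (free_operad E))
    n r (e : (0 + n)%N = r) c d q (f : c + d = q) i a (b : free_operad E n d) :
  (forall r q, is_subspace (S r q)) -> low_arity_span a -> S n d b ->
  S r q (comp e f i a b).
Proof.
move=> sS; case: c f a => [[|c]|c] f a.
- move=> [z ->] hb; rewrite compZl; apply: subspaceZ => //.
  have rn : n = r by rewrite -e.
  have qd : d = q by rewrite -f add0r.
  by case: r / rn e => e; case: q / qd f => f; rewrite comp_unit_l.
- by move=> -> _; rewrite comp_0l; apply: subspace0.
- by move=> -> _; rewrite comp_0l; apply: subspace0.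
Qed.

Lemma comp_low_arity_r (S : subcollection (free_operad E))
    m r (e : (m + 0)%N = r) c d q (f : c + d = q) i (a : free_operad E m c) b :
  (forall r q, is_subspace (S r q)) -> S m c a -> low_arity_span b ->
  S r q (comp e f i a b).
Proof.
move=> sS; case: d f b => [[|d]|d] f b.
- move=> ha [z ->]; rewrite compZr; apply: subspaceZ => //.
  have rm : m = r by rewrite -e addn0.
  have qc : c = q by rewrite -f addr0.
  by case: r / rm e => e; case: q / qc f => f; rewrite comp_unit_r.
- by move=> _ ->; rewrite comp_0r; apply: subspace0.
- by move=> _ ->; rewrite comp_0r; apply: subspace0.
Qed.

(** Elements of the standard filtration are arbitrary in F(E)(3), whereas [from_model] is shown to
    invert [to_model] on the span of composites of two generators; this closes the gap. *)
Lemma low_arity_spanP n d (x : free_operad E n d) : low_arity_span x.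
Proof.
move: n d x; apply: free_operad_ind.
- exact: low_arity_span_subspace.
- case=> [|[|[|n]]] // d s x.
  + by rewrite (_ : s = 1%g) ?act_id //; apply/permP => j; rewrite !ord1.
  + by move=> [y ->]; exists (act s y); rewrite col_hom_act.
  + apply: (@lin_span_sub _ _ _ [set x | lin_span (two_generators E 2%N d) (act s x)]%classic).
      split=> [|c y z hy hz]; rewrite /mkset.
        by rewrite act0; apply: (low_arity_span0 2%N).
      by rewrite act_linear; case: (low_arity_span_subspace 2%N d) => _; apply.
    move=> _ [m [n [e [c [d' [f [i [a [b [t ->]]]]]]]]]]; apply: lin_span_mem.
    by exists m, n, e, c, d', f, i, a, b, (s * t)%g; rewrite act_act.
- by exists 1; rewrite scale1r.
- move=> m n r e c d q f i a b ha hb.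
  case: m e i a ha => [|m] e i a ha.
    exact: (comp_low_arity_l (S := low_arity_span) e f i low_arity_span_subspace).
  case: n e b hb => [|n] e b hb.
    exact: (comp_low_arity_r (S := low_arity_span) e f i low_arity_span_subspace).
  case: m n e i a b ha hb => [|m] [|n] e i a b ha hb.
    case: r / e; move: ha hb => [x ->] [y ->]; apply: lin_span_mem.
    by exists 1%N, 1%N, erefl, c, d, f, i, x, y, 1%g; rewrite act_id.
  + by case: r e => [|[|[|r]]] e //; exfalso; lia.
  + by case: r e => [|[|[|r]]] e //; exfalso; lia.
  + by case: r e => [|[|[|r]]] e //; exfalso; lia.
- case=> [|[|[|n]]] // d x.
  + by rewrite [x]E0 ?col_hom0; [apply: low_arity_span0|left].
  + by exists x.
  + by rewrite [x]E0 ?col_hom0; [apply: low_arity_span0|left].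
Qed.

Lemma std_filtration_order n d (p : midx n) (x : free_operad E n d) :
  std_filtration (free_gen E) n d p x ->
  forall i, order_cond i (p i) (to_model n d x).
Proof.
move=> hx; suff: pullback to_model (@model_filtration k) p x by [].
apply: hx.
- exact: pullback_D (model_filtration_D k).
- exact: pullback_saturated (@model_filtration_saturated k).
move=> {n d p x} n d x i; rewrite ffunE.
have [n1|/eqP n1] := eqVneq n 1%N; last first.
  by rewrite [x]E0 ?col_hom0 ?(col_hom0 to_model); [apply: order_cond0|left].
by move: x i; rewrite n1.
Qed.

(** Going round Z/3 takes an odd number of steps, so f z = - f z. *)
Lemma alternating_zero (f : 'I_3 -> k) :
  (forall z, f (z + 1) = - f z) -> forall z, f z = 0.
Proof.
move=> h z; have /eqP : f z = - f z.
  rewrite -{2}[z]addr0 (_ : 0 = 1 + 1 + 1); last exact: val_inj.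
  by rewrite !addrA !h !opprK.
rewrite -subr_eq0 opprK -mulr2n -mulr_natl mulf_eq0 (negPf two_neq0).
exact: eqP.
Qed.

(** Each entry is followed round Z/3. The entry 00 changes sign at every step; the entry 01 passes
    to 10 and returns with the opposite sign after two steps, which amount to a shift by one. Hence
    these vanish, while the entry 11 is carried along unchanged. *)
Lemma dual_cond_solution (u : model_car k) :
  (forall i, dual_cond i u) ->
  forall z, u z = \matrix_(x, y) (if (x == 1) && (y == 1) then u 0 1 1 else 0).
Proof.
move=> hu.
have h z x y : (-1) ^+ (y == 1) * u (z + 1) x y + u (z - 1) y x = 0.
  by have /matrixP/(_ x y) := hu z; rewrite mxE mul_flipE !mxE.
have h01 z : u (z + 1) 0 1 = u (z - 1) 1 0.
  apply/eqP; rewrite eq_sym -subr_eq0 addrC; apply/eqP.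
  by rewrite -[RHS](h z 0 1) eqxx expr1 mulN1r.
have h10 z : u (z + 1) 1 0 = - u (z - 1) 0 1.
  by apply/eqP; rewrite -subr_eq0 opprK; have := h z 1 0; rewrite mul1r => ->.
have h11 z : u (z + 1) 1 1 = u (z - 1) 1 1.
  apply/eqP; rewrite eq_sym -subr_eq0 addrC; apply/eqP.
  by rewrite -[RHS](h z 1 1) eqxx expr1 mulN1r.
have n1 (z : 'I_3) : z - 1 - 1 = z + 1.
  by rewrite -addrA; congr (_ + _); apply: val_inj.
have h00 z : u z 0 0 = 0.
  apply: (@alternating_zero (fun z => u z 0 0)) => w.
  apply/eqP; rewrite -subr_eq0 opprK -[u w](congr1 u (subrK 1 w)) -n1.
  by have := h (w - 1) 0 0; rewrite mul1r addrC => ->.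
have h01z z : u z 0 1 = 0.
  apply: (@alternating_zero (fun z => u z 0 1)) => w.
  by rewrite h01 -[w - 1](subrK 1) h10 n1 subrK.
have h10z z : u z 1 0 = 0 by rewrite -[z](subrK 1) h10 h01z oppr0.
have h11z z : u z 1 1 = u 0 1 1.
  have uN1 : u (-1) 1 1 = u 0 1 1.
    by rewrite (_ : -1 = 1 + 1) ?h11 ?subrr //; apply: val_inj.
  elim/ord3P: z => //.
  have := h11 0; rewrite add0r sub0r => ->; exact: uN1.
move=> z; apply/matrixP => x y; rewrite mxE.
by elim/ord2P: x; elim/ord2P: y => /=.
Qed.

Lemma std_filtration_jacobiator x :
  std_filtration (free_gen E) 2%N 0 (midx_const 2 1) x ->
  exists c, x = c *: jacobiator (gen asym_part).
Proof.
move=> /std_filtration_order hx; set u := to_model 2%N 0 x in hx.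
exists (u 0 1 1); rewrite -(from_to_model_span (low_arity_spanP x)) -/u.
have {}hx : forall i, dual_cond i u.
  by move=> i; case: (hx i) => _; apply; rewrite ffunE.
(* The substitution z -> -1 - z reproduces the rotations of [from_model]. *)
rewrite /jacobiator /cyclic_sum scaler_sumr (reindex_inj (inj_comp (addrI (-1)) oppr_inj)).
apply: eq_bigr => z _; rewrite -actZ; congr (act _ _).
have -> : compose2 0 (gen asym_part) (gen asym_part) = block_element (delta_mx 1 1).
  rewrite /block_element (bigD1 1) // [X in _ = _ + X]big1 => [|i /andP[_ i1]].
    rewrite (bigD1 1) // [X in _ = _ + X + _]big1 => [|j /andP[_ j1]].
      rewrite mxE !eqxx scale1r; exact: esym (etrans (addr0 _) (addr0 _)).
    by rewrite mxE (negPf j1) andbF scale0r.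
  by rewrite big1 // => j _; rewrite mxE (negPf i1) scale0r.
rewrite (dual_cond_solution hx) /block_element scaler_sumr; apply: eq_bigr => i _.
rewrite scaler_sumr; apply: eq_bigr => j _; rewrite scalerA !mxE.
by case: ifP; rewrite ?mulr1 ?mulr0.
Qed.

End SingleBinary.

(** * Presentations *)

Section OperadMorphisms.
Variable k : fieldType.
Implicit Types P Q T : operad k.
Local Open Scope classical_set_scope.

Definition op_id P : op_hom P P :=
  @OpHom k P P (@ColHom k P P (fun _ _ x => x)
    (fun _ _ _ _ _ => erefl) (fun _ _ _ _ => erefl)) erefl
    (fun _ _ _ _ _ _ _ _ _ _ _ => erefl).

Definition col_comp (C D F : collection k) (g : col_hom D F) (f : col_hom C D) :
    col_hom C F.
Proof.
refine (@ColHom k C F (fun n d x => g n d (f n d x)) _ _).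
- by move=> n d c x y; rewrite !col_hom_linear.
- by move=> n d s x; rewrite !col_hom_act.
Defined.

Definition op_comp P Q T (g : op_hom Q T) (f : op_hom P Q) : op_hom P T.
Proof.
refine (@OpHom k P T (col_comp g f) _ _).
- by rewrite /= !op_hom_unit.
- by move=> m n r e c d q f0 i a b; rewrite /= !op_hom_comp.
Defined.

Lemma op_iso_sym P Q : op_iso P Q -> op_iso Q P.
Proof.
move=> [f fbij].
have inv n d : exists g, cancel (fun x => f n d x) g /\ cancel g (fun x => f n d x).
  by have [g fK gK] := fbij n d; exists g.
pose h n d := projT1 (cid (inv n d)).
have fK n d : cancel (f n d) (h n d) := (projT2 (cid (inv n d))).1.
have hK n d : cancel (h n d) (f n d) := (projT2 (cid (inv n d))).2.
have h_lin n d c (x y : Q n d) : h n d (c *: x + y) = c *: h n d x + h n d y.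
  by apply: (can_inj (@fK n d)); rewrite col_hom_linear !hK.
have h_act n d (s : 'S_n.+1) (x : Q n d) : h n d (act s x) = act s (h n d x).
  by apply: (can_inj (@fK n d)); rewrite col_hom_act !hK.
unshelve eexists (@OpHom k Q P (ColHom h_lin h_act) _ _).
- by apply: (can_inj (@fK _ _)); rewrite op_hom_unit /= hK.
- move=> m n r e c d q f0 i a b; apply: (can_inj (@fK _ _)).
  by rewrite op_hom_comp /= !hK.
- by move=> n d; exists (f n d) => x /=; [apply: hK|apply: fK].
Qed.

Lemma op_iso_trans P Q T : op_iso P Q -> op_iso Q T -> op_iso P T.
Proof.
move=> [f fb] [g gb]; exists (op_comp g f) => n d.
exact: bij_comp (gb n d) (fb n d).
Qed.

Lemma surj_inj_bij (A B : Type) (f : A -> B) :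
  injective f -> (forall y, exists x, f x = y) -> bijective f.
Proof. by move=> inj /choice [g gK]; exists g => // x; apply: inj. Qed.

(** The first isomorphism theorem, keeping track of the generators. *)
Lemma presented_hom (E : collection k) (R : subcollection (free_operad E)) P
    (h : op_hom (free_operad E) P) :
  (forall n d x, h n d x = 0 <-> ideal_gen R n d x) ->
  (forall n d y, exists x, h n d x = y) ->
  exists2 f : op_hom (presented_operad R) P, op_bijective f &
    forall n d (x : E n d), f n d (presented_gen R n d x) = h n d (free_gen E n d x).
Proof.
move=> ker surj; pose pr := quotient_proj (ideal_gen_ideal R).
have prP n d (x y : free_operad E n d) :
    pr n d x = pr n d y <-> h n d x = h n d y.
  rewrite quotient_projP -ker -scaleN1r addrC col_hom_linear scaleN1r addrC.
  by split=> [/eqP|->]; rewrite ?subrr // subr_eq0 => /eqP.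
have lift n d : exists F : presented_operad R n d -> P n d,
    forall x, F (pr n d x) = h n d x.
  have /choice [s sP] := @quotient_proj_surj _ _ _ (ideal_gen_ideal R) n d.
  by exists (fun q => h n d (s q)) => x; apply/prP; rewrite sP.
pose f n d := projT1 (cid (lift n d)).
have fE n d x : f n d (pr n d x) = h n d x := projT2 (cid (lift n d)) x.
have prS n d := @quotient_proj_surj _ _ _ (ideal_gen_ideal R) n d.
have f_lin n d c x y : f n d (c *: x + y) = c *: f n d x + f n d y.
  have [x' <-] := prS n d x; have [y' <-] := prS n d y.
  by rewrite -col_hom_linear !fE col_hom_linear.
have f_act n d (s : 'S_n.+1) x : f n d (act s x) = act s (f n d x).
  by have [x' <-] := prS n d x; rewrite -col_hom_act !fE col_hom_act.
unshelve eexists (@OpHom k (presented_operad R) P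
  (@ColHom k (presented_operad R) P f f_lin f_act) _ _).
- exact: etrans (fE _ _ (op_unit (free_operad E))) (op_hom_unit h).
- move=> m n r e c d q f0 i a b; have [a' <-] := prS m c a; have [b' <-] := prS n d b.
  apply: etrans (congr1 (f r q) (esym (op_hom_comp pr e f0 i a' b'))) _.
  by rewrite /= !fE op_hom_comp.
- move=> n d; apply: surj_inj_bij => [x y|y] /=.
    have [x' <-] := prS n d x; have [y' <-] := prS n d y.
    by rewrite !fE => /prP.
  by have [x <-] := surj n d y; exists (pr n d x).
- by move=> n d x; apply: fE.
Qed.

(** The kernel depends on [g] alone, so all presentations with this generator map have the same
    ideal of relations. *)
Lemma presentation_kernel (E : collection k) P (g : col_hom E P)
    (R : subcollection (free_operad E)) :
  is_presentation g R ->
  forall n d x, free_lift g n d x = 0 <-> ideal_gen R n d x.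
Proof.
move=> [f fbij fg] n d x; pose pr := quotient_proj (ideal_gen_ideal R).
have -> : free_lift g n d x = f n d (pr n d x).
  apply: (free_hom_ext (f := free_lift g) (f' := op_comp f pr)) => {n d x} n d x.
  by rewrite free_lift_gen -fg.
rewrite -[X in ideal_gen _ _ _ X]subr0 -(quotient_projP (ideal_gen_ideal R)).
rewrite -/pr (col_hom0 pr); split=> [h|->]; last exact: col_hom0.
by apply: (bij_inj (fbij n d)); rewrite h col_hom0.
Qed.

Lemma ideal_gen_sub P (R I : subcollection P) :
  is_ideal I -> (forall n d, R n d `<=` I n d) ->
  forall n d, ideal_gen R n d `<=` I n d.
Proof. by move=> hI RI n d x; apply. Qed.

Lemma ideal_gen_mem P (R : subcollection P) n d : R n d `<=` ideal_gen R n d.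
Proof. by move=> x Rx I hI; apply. Qed.

Lemma preimage_ideal P Q (h : op_hom P Q) (I : subcollection Q) :
  is_ideal I -> is_ideal (fun n d => [set x | I n d (h n d x)]).
Proof.
move=> hI; split.
- move=> n d; split=> [|c x y hx hy]; rewrite /mkset.
    by rewrite col_hom0; apply: subspace0 (ideal_subspace hI n d).
  by rewrite col_hom_linear; case: (ideal_subspace hI n d) => _; apply.
- by move=> n d s x; rewrite /mkset col_hom_act; apply: ideal_act.
- by move=> *; rewrite /mkset op_hom_comp; apply: ideal_comp_l.
- by move=> *; rewrite /mkset op_hom_comp; apply: ideal_comp_r.
Qed.

Lemma zero_ideal P : is_ideal (fun n d => [set x : P n d | x = 0]).
Proof.
split.
- by move=> n d; split=> // c x y -> ->; rewrite scaler0 addr0.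
- by move=> n d s x ->; rewrite /mkset act0.
- by move=> m n r e c d q f i a b ->; rewrite /mkset comp_0l.
- by move=> m n r e c d q f i a b ->; rewrite /mkset comp_0r.
Qed.

Lemma presented_transport (E E' : collection k) (R : subcollection (free_operad E))
    (R' : subcollection (free_operad E')) (phi : op_hom (free_operad E) (free_operad E'))
    (psi : op_hom (free_operad E') (free_operad E)) :
  (forall n d x, psi n d (phi n d (free_gen E n d x)) = free_gen E n d x) ->
  (forall n d y, phi n d (psi n d (free_gen E' n d y)) = free_gen E' n d y) ->
  (forall n d x, R n d x -> ideal_gen R' n d (phi n d x)) ->
  (forall n d y, R' n d y -> ideal_gen R n d (psi n d y)) ->
  op_iso (presented_operad R) (presented_operad R').
Proof.
move=> psiphi phipsi phiR psiR'.
have psiK n d x : psi n d (phi n d x) = x.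
  exact: (free_hom_ext (f := op_comp psi phi) (f' := op_id _)).
have phiK n d x : phi n d (psi n d x) = x.
  exact: (free_hom_ext (f := op_comp phi psi) (f' := op_id _)).
pose pr := quotient_proj (ideal_gen_ideal R').
have [] := @presented_hom E R (presented_operad R') (op_comp pr phi).
- move=> n d x; have -> : op_comp pr phi n d x = pr n d (phi n d x) by [].
  rewrite -(col_hom0 pr) quotient_projP subr0; split.
    rewrite -{2}[x]psiK; apply: (ideal_gen_sub (preimage_ideal psi (ideal_gen_ideal R))).
    exact: psiR'.
  apply: (ideal_gen_sub (preimage_ideal phi (ideal_gen_ideal R'))).
  exact: phiR.
- move=> n d y; have [x <-] := @quotient_proj_surj _ _ _ (ideal_gen_ideal R') n d y.
  by exists (psi n d x); rewrite /= phiK.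
by move=> f fbij _; exists f.
Qed.

Lemma free_presentation (E : collection k) (R : subcollection (free_operad E)) :
  (forall n d x, R n d x -> x = 0) ->
  is_presentation (free_gen E) R.
Proof.
move=> R0; have [] := @presented_hom E R _ (op_id (free_operad E)).
- move=> n d x; split=> [x0|].
    have -> : x = 0 := x0; exact: subspace0 (ideal_subspace (ideal_gen_ideal R) n d).
  exact: (ideal_gen_sub (@zero_ideal (free_operad E)) R0).
- by move=> n d y; exists y.
by move=> f fbij fg; exists f.
Qed.

End OperadMorphisms.

(** * Classification *)

Section Transfer.
Variables (k : fieldType) (two_neq0 : 2%:R != 0 :> k) (E F : collection k).
Hypothesis E0 : forall n d (x : E n d), n <> 1%N \/ d <> 0 -> x = 0.
Variables (mu : E 1%N 0) (nu : F 1%N 0).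
Hypothesis mu_gen :
  forall x, exists c : 'S_2 -> k, x = \sum_(s : 'S_2) c s *: act s mu.

(** Sending [mu] to [nu] need not extend equivariantly if [mu] has more symmetry. Coordinates, being
    0 on a vanishing part, give an equivariant map in every case. *)
Definition transfer_fun (x : E 1%N 0) : F 1%N 0 :=
  sym_coord mu x *: sym_part nu + asym_coord mu x *: asym_part nu.

Fact transfer_linear c x y :
  transfer_fun (c *: x + y) = c *: transfer_fun x + transfer_fun y.
Proof.
have /rowP h := coords_linear two_neq0 mu_gen c x y.
have := h 0; have := h 1; rewrite !mxE /= => h1 h0.
by rewrite /transfer_fun h0 h1 !scalerDl -!scalerA addrACA -scalerDr.
Qed.

Fact transfer_act (s : 'S_2) x : transfer_fun (act s x) = act s (transfer_fun x).
Proof.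
have /rowP h := coords_act two_neq0 mu_gen s x.
have := h 0; have := h 1; rewrite !mul_flipE !mxE /= => h1 h0.
rewrite /transfer_fun h0 h1 actD !actZ; elim/perm2P: s {h h0 h1}.
  by rewrite !act_id odd_perm1 !mul1r.
by rewrite act_sym_part act_asym_part odd_swap2 /= mul1r expr1 mulN1r scaleNr scalerN.
Qed.

Definition transfer_col : col_hom E F := binary_hom transfer_linear transfer_act.

Definition transfer : op_hom (free_operad E) (free_operad F) :=
  free_lift (col_comp (free_gen F) transfer_col).

Lemma transfer_gen x :
  transfer 1%N 0 (free_gen E 1%N 0 x) = free_gen F 1%N 0 (transfer_fun x).
Proof. exact: free_lift_gen. Qed.

Lemma transfer_jacobiator : (asym_part mu = 0 -> asym_part nu = 0) ->
  transfer 2%N 0 (jacobiator (free_gen E 1%N 0 (asym_part mu))) =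
  jacobiator (free_gen F 1%N 0 (asym_part nu)).
Proof.
move=> mu_nu; rewrite /jacobiator /cyclic_sum.
rewrite (big_morph _ (@col_homD _ _ _ transfer 2%N 0) (col_hom0 transfer 2%N 0)).
apply: eq_bigr => z _; rewrite col_hom_act; congr (act _ _).
rewrite /compose2 op_hom_comp !transfer_gen.
suff -> : transfer_fun (asym_part mu) = asym_part nu by [].
have -> : asym_part mu = 0 *: sym_part mu + 1 *: asym_part mu.
  by rewrite scale0r add0r scale1r.
rewrite /transfer_fun !coordE // if_same scale0r add0r.
by case: eqP => [/mu_nu ->|_]; rewrite ?scale0r ?scale1r.
Qed.

End Transfer.

Section Classification.
Variables (k : fieldType) (two_neq0 : 2%:R != 0 :> k).
Local Open Scope classical_set_scope.

Lemma transferK (E F : collection k)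
    (E0 : forall n d (x : E n d), n <> 1%N \/ d <> 0 -> x = 0)
    (mu : E 1%N 0) (nu : F 1%N 0)
    (mu_gen : forall x, exists c : 'S_2 -> k, x = \sum_(s : 'S_2) c s *: act s mu)
    (nu_gen : forall x, exists c : 'S_2 -> k, x = \sum_(s : 'S_2) c s *: act s nu) :
  (sym_part nu = 0 -> sym_part mu = 0) -> (asym_part nu = 0 -> asym_part mu = 0) ->
  forall n d x,
    transfer two_neq0 mu nu_gen n d (transfer two_neq0 nu mu_gen n d (free_gen E n d x)) =
    free_gen E n d x.
Proof.
move=> sym asym n d x.
have [n1|/eqP n1] := eqVneq n 1%N; last by rewrite [x]E0 ?col_hom0 //; left.
have [d0|/eqP d0] := eqVneq d 0; last by rewrite [x]E0 ?col_hom0 //; right.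
move: x; rewrite n1 d0 => x; rewrite !transfer_gen; congr (free_gen E 1%N 0 _).
rewrite [RHS](coordK two_neq0 mu_gen) {1}/transfer_fun /transfer_fun !coordE //.
congr (_ + _); first by case: eqP => [/sym ->|]; rewrite ?scaler0.
by case: eqP => [/asym ->|]; rewrite ?scaler0.
Qed.

Section Relations.
Variables (E : collection k) (P : operad k) (g : col_hom E P).
Hypothesis E0 : forall n d (x : E n d), n <> 1%N \/ d <> 0 -> x = 0.
Variable mu : E 1%N 0.
Hypothesis mu_gen :
  forall x, exists c : 'S_2 -> k, x = \sum_(s : 'S_2) c s *: act s mu.
Variables R R' : subcollection (free_operad E).
Hypotheses (gR : is_presentation g R) (gR' : is_presentation g R').
Hypothesis R_tight :
  forall n d, @R n d `<=` std_filtration (free_gen E) n d (midx_const n 1).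
Hypothesis R'_quadratic : forall n d, @R' n d `<=` lin_span (two_generators E n d).

Local Notation jac := (jacobiator (free_gen E 1%N 0 (asym_part mu))).

Lemma quadratic_concentrated n d x : @R' n d x -> n <> 2%N \/ d <> 0 -> x = 0.
Proof.
move=> /R'_quadratic hx nd; apply: (@lin_span_sub _ _ _ [set y : free_operad E n d | y = 0] _ _ x hx).
  exact: ideal_subspace (zero_ideal (free_operad E)) n d.
move=> y hy; rewrite /mkset => {hx}; clear x.
move: n d y hy nd.
apply: (two_generators_ind E0 (S := fun n d y => n <> 2%N \/ d <> 0 -> y = 0)) => //.
by move=> s a b [].
Qed.

Definition tight_ideal : subcollection (free_operad E) :=
  fun n d => [set x | ((n < 2)%N -> x = 0) /\
    ((n < 3)%N -> std_filtration (free_gen E) n d (midx_const n 1) x)].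

(** Members vanish below arity 3. Composition with an operation of arity at least 2 lands in arity
    at least 4, where nothing is required; composition with a unary one is multiplication by a
    scalar. *)
Lemma tight_ideal_ideal : is_ideal tight_ideal.
Proof.
have [[Fm _] _ _ _] := std_filtration_least (free_gen E).
split.
- move=> n d; split=> [|c x y [hx tx] [hy ty]].
    by split=> // _; apply: subspace0 (mf_subspace Fm _ _).
  split=> n2; first by rewrite hx // hy // scaler0 addr0.
  by case: (mf_subspace Fm d (midx_const n 1)) => _; apply; [apply: tx|apply: ty].
- move=> n d s x [hx tx]; split=> n2; first by rewrite hx // act0.
  suff -> : midx_const n 1 = midx_perm (midx_const n 1) s.
    by rewrite -(mf_act Fm); exists x => //; apply: tx.
  by apply/ffunP => i; rewrite !ffunE.
- move=> m n r e c d q f i a b [ha ta].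
  have [m2|m2] := ltnP m 2.
    rewrite ha // comp_0l; split=> // _; exact: subspace0 (mf_subspace Fm _ _).
  split=> r2; first by lia.
  have n0 : n = 0%N by lia.
  move: e b; rewrite n0 => e b; apply: (comp_low_arity_r
    (S := fun n d => std_filtration (free_gen E) n d (midx_const n 1))).
  + by move=> r' q'; apply: (mf_subspace Fm).
  + by apply: ta; lia.
  + exact: low_arity_spanP.
- move=> m n r e c d q f i a b [hb tb].
  have [n2|n2] := ltnP n 2.
    rewrite hb // comp_0r; split=> // _; exact: subspace0 (mf_subspace Fm _ _).
  split=> r2; first by lia.
  have m0 : m = 0%N by lia.
  move: e i a; rewrite m0 => e i a; apply: (comp_low_arity_l
    (S := fun n d => std_filtration (free_gen E) n d (midx_const n 1))).
  + by move=> r' q'; apply: (mf_subspace Fm).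
  + exact: low_arity_spanP.
  + by apply: tb; lia.
Qed.

Lemma ideals_eq n d x : ideal_gen R n d x <-> ideal_gen R' n d x.
Proof. by rewrite -(presentation_kernel gR) -(presentation_kernel gR'). Qed.

(* As (R) = (R') vanishes below arity 3, so does R; hence composing with R
   produces nothing in arity 3 beyond the span of R itself. *)
Lemma tight_quadratic_jacobiator x : @R' 2%N 0 x -> exists c, x = c *: jac.
Proof.
pose high : subcollection (free_operad E) := fun n d => [set x | (n < 2)%N -> x = 0].
have high_ideal : is_ideal high.
  split.
  - by move=> n d; split=> // c y z hy hz n2; rewrite hy // hz // scaler0 addr0.
  - by move=> n d s y hy n2; rewrite hy // act0.
  - by move=> m n r e c d q f i a b ha r2; rewrite ha ?comp_0l //; lia.
  - by move=> m n r e c d q f i a b hb r2; rewrite hb ?comp_0r //; lia.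
have R'high n d : ideal_gen R' n d `<=` high n d.
  move: n d; apply: (ideal_gen_sub high_ideal) => n d y /quadratic_concentrated y0 n2.
  by apply: y0; left; lia.
move=> /ideal_gen_mem /ideals_eq Rx.
have [|_] := ideal_gen_sub tight_ideal_ideal _ Rx.
  move=> n d y Ry; split=> [|_]; last exact: R_tight.
  move=> n2; have : ideal_gen R n d y by apply: ideal_gen_mem.
  by move=> /ideals_eq /R'high; apply.
by move/(_ isT); apply: std_filtration_jacobiator.
Qed.

(** The scalar [z] absorbs the normalisation of the target relation: -1 for [jacobi], 1 for
    [LieAdm_relation]. *)
Lemma tight_quadratic_iso (F : collection k) (nu : F 1%N 0) (z : k)
    (F0 : forall n d (x : F n d), n <> 1%N \/ d <> 0 -> x = 0)
    (nu_gen : forall x, exists c : 'S_2 -> k, x = \sum_(s : 'S_2) c s *: act s nu) :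
  z != 0 -> (sym_part mu = 0 <-> sym_part nu = 0) ->
  (asym_part mu = 0 <-> asym_part nu = 0) ->
  (exists2 c, @R' 2%N 0 (c *: jac) & c != 0) ->
  op_iso P (presented_operad
    (single_relation (z *: jacobiator (free_gen F 1%N 0 (asym_part nu))))).
Proof.
move=> z0 [sym1 sym2] [asym1 asym2] [c Rc c0].
apply: (@op_iso_trans _ _ (presented_operad R')).
  by apply: op_iso_sym; have [f fbij _] := gR'; exists f.
apply: (presented_transport (phi := transfer two_neq0 nu mu_gen)
  (psi := transfer two_neq0 mu nu_gen)).
- exact: transferK.
- exact: transferK.
- move=> n d x Rx; set R1 := single_relation _.
  have [nd|/not_orP[/contrapT n2 /contrapT d0]] := pselect (n <> 2%N \/ d <> 0).
    rewrite (quadratic_concentrated Rx nd) col_hom0.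
    exact: subspace0 (ideal_subspace (ideal_gen_ideal R1) n d).
  move: x Rx; rewrite n2 d0 => x /tight_quadratic_jacobiator [a ->].
  rewrite col_homZ transfer_jacobiator // -[a]mulr1 -(mulVf z0) mulrA -scalerA.
  apply: subspaceZ (ideal_subspace (ideal_gen_ideal R1) 2%N 0) _ _ _.
  exact: ideal_gen_mem (SingleRelation _).
- move=> n d _ []; rewrite col_homZ transfer_jacobiator //.
  rewrite -[jac]scale1r -(mulVf c0) -scalerA.
  by do 2![apply: subspaceZ (ideal_subspace (ideal_gen_ideal R') 2%N 0) _ _ _];
    apply: ideal_gen_mem.
Qed.

End Relations.
End Classification.

(** * The operads Lie and LieAdm *)

Section Examples.
Variable k : fieldType.
Local Open Scope classical_set_scope.

Lemma binary_collection0 (V : lmodType k) (rho : 'S_2 -> V -> V) lin id act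
    n d (x : @binary_collection k V rho lin id act n d) :
  n <> 1%N \/ d <> 0 -> x = 0.
Proof.
have rV0 (y : 'rV[k]_0) : y = 0 by apply/rowP => -[].
by move=> nd; move: n d x nd => [|[|n]] [[|d]|d] x [] //.
Qed.

Lemma jacobiator0 (P : operad k) : jacobiator (0 : P 1%N 0) = 0.
Proof.
rewrite /jacobiator /compose2 comp_0l /cyclic_sum big1 // => z _; exact: act0.
Qed.

Lemma jacobiator_quadratic (E : collection k) (x : E 1%N 0) :
  lin_span (two_generators E 2%N 0) (jacobiator (free_gen E 1%N 0 x)).
Proof.
have sS := @lin_span_subspace _ _ (two_generators E 2%N 0).
have mem z : lin_span (two_generators E 2%N 0)
    (act (affine false z) (compose2 0 (free_gen E 1%N 0 x) (free_gen E 1%N 0 x))).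
  apply: lin_span_mem; exists 1%N, 1%N, erefl, 0, 0, (add0r 0), 0, x, x.
  by exists (affine false z).
rewrite /jacobiator cyclic_sumE -[X in X + _ + _]act_id -affine0.
by apply: (subspaceD sS) => //; apply: (subspaceD sS).
Qed.

Lemma single_relation_presentation (E : collection k) n d (y : free_operad E n d) :
  is_presentation (presented_gen (single_relation y)) (single_relation y).
Proof. by exists (op_id _) => // m c; exists id. Qed.

Lemma jacobiator_presentation (E : collection k) (b : E 1%N 0) (z : k) y :
  act swap2 b = - b -> y = z *: jacobiator (free_gen E 1%N 0 b) ->
  is_tight (presented_gen (single_relation y)) /\
  is_quadratic (presented_gen (single_relation y)).
Proof.
move=> anti ->; split; exists (single_relation (z *: jacobiator (free_gen E 1%N 0 b)));
  try exact: single_relation_presentation.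
- have [[Fm Fc] Fs Fg _] := std_filtration_least (free_gen E).
  move=> n d _ []; apply: subspaceZ (mf_subspace Fm _ _) _ _ _.
  apply: (@jacobiator_filtration _ _ _ (conj Fm Fc) Fs); last exact: Fg.
  by rewrite -col_hom_act anti -scaleN1r col_homZ scaleN1r.
- move=> n d _ []; apply: subspaceZ (@lin_span_subspace _ _ _) _ _ _.
  exact: jacobiator_quadratic.
Qed.

Section CharacteristicNotTwo.
Hypothesis two_neq0 : 2%:R != 0 :> k.

(* Normalised so that the antisymmetrisation of the generator is the bracket. *)
Definition Lie_half : Lie_collection k 1%N 0 := (2%:R^-1 : k^o).

Lemma act_Lie (x : Lie_collection k 1%N 0) : act swap2 x = - x.
Proof.
by rewrite -[LHS]/((-1) ^+ swap2 *: (x : k^o)) odd_swap2 expr1 scaleN1r.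
Qed.

Lemma Lie_half_gen (x : Lie_collection k 1%N 0) :
  exists c : 'S_2 -> k, x = \sum_(s : 'S_2) c s *: act s Lie_half.
Proof.
exists (fun s => if s == 1%g then (x : k^o) * 2%:R else 0).
rewrite sum_perm2 eqxx (negPf perm2_neq) scale0r addr0 act_id.
by rewrite -[RHS]/((x : k^o) * 2%:R * 2%:R^-1) mulfK.
Qed.

Lemma Lie_asym_part : asym_part Lie_half = (1 : k^o).
Proof.
rewrite /asym_part act_Lie opprK -[LHS]/(2%:R^-1 + 2%:R^-1 : k).
by field.
Qed.

Lemma jacobiE :
  jacobi k = -1 *: jacobiator (free_gen (Lie_collection k) 1%N 0 (asym_part Lie_half)).
Proof.
rewrite Lie_asym_part scaleN1r; apply: jacobi_jacobiator.
by rewrite -col_hom_act act_Lie -[in LHS]scaleN1r col_homZ scaleN1r.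
Qed.

Definition LieAdm_unit : LieAdm_collection k 1%N 0 :=
  ([ffun s => (s == 1%g)%:R] : {ffun 'S_2 -> k^o}).

Lemma act_LieAdm (s t : 'S_2) (h : {ffun 'S_2 -> k^o}) :
  (act s (h : LieAdm_collection k 1%N 0) : {ffun 'S_2 -> k^o}) t = h (t * s)%g.
Proof. by rewrite -[LHS]/(regular_act s h t) ffunE. Qed.

Lemma LieAdm_unit_gen (x : LieAdm_collection k 1%N 0) :
  exists c : 'S_2 -> k, x = \sum_(s : 'S_2) c s *: act s LieAdm_unit.
Proof.
exists (fun s => (x : {ffun 'S_2 -> k^o}) s); rewrite sum_perm2.
apply/ffunP => t; rewrite !(ffunE, act_LieAdm) !mulg1 -[RHS]/(_ * _ + _ * _ : k).
by elim/perm2P: t; rewrite ?mul1g ?swap2K ?eqxx ?(negPf perm2_neq)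
  !(mulr1, mulr0, addr0, add0r).
Qed.

Lemma LieAdm_parts_neq0 :
  (sym_part LieAdm_unit != 0) * (asym_part LieAdm_unit != 0).
Proof.
split; apply/eqP => /ffunP /(_ 1%g); rewrite !(ffunE, act_LieAdm) mul1g eqxx;
by rewrite (negPf perm2_neq) ?subr0 ?addr0 => /eqP; rewrite oner_eq0.
Qed.

Lemma LieAdm_relationE :
  LieAdm_relation k =
  1 *: jacobiator (free_gen (LieAdm_collection k) 1%N 0 (asym_part LieAdm_unit)).
Proof.
rewrite scale1r /asym_part col_homD -[- act _ _]scaleN1r col_homZ scaleN1r col_hom_act.
rewrite -alternating_associator; apply: eq_bigr => s _.
by rewrite /associator inord2.
Qed.

End CharacteristicNotTwo.
End Examples.

Theorem theorem3p10 (k : fieldType) (char0 : [pchar k] =i pred0) :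
  (forall (E : collection k) (P : operad k) (g : col_hom E P),
     single_binary E -> is_tight g -> is_quadratic g ->
     op_iso P (free_operad E) \/
     op_iso P (Lie_operad k) \/
     op_iso P (LieAdm_operad k)) /\
  (forall E : collection k, single_binary E ->
     is_tight (free_gen E) /\ is_quadratic (free_gen E)) /\
  (single_binary (Lie_collection k) /\
   is_tight (Lie_gen k) /\
   is_quadratic (Lie_gen k)) /\
  (single_binary (LieAdm_collection k) /\
   is_tight (LieAdm_gen k) /\
   is_quadratic (LieAdm_gen k)).
Proof.
have two_neq0 : 2%:R != 0 :> k by have := char0 2%N; rewrite !inE /= => /negbT.
split; last first.
  split.
    (* With the empty set of relations both conditions are vacuous. *)
    move=> E _; have pres := @free_presentation k E (fun _ _ => set0%classic).
    by split; exists (fun _ _ => set0%classic); try (by move=> n d x []); apply: pres.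
  split.
    split; last exact: (jacobiator_presentation (act_Lie _) (jacobiE two_neq0)).
    split; first exact: binary_collection0.
    exists (Lie_half k); last exact: Lie_half_gen.
    by apply/eqP; rewrite -[X in X == _]/(2%:R^-1 : k) invr_eq0.
  split.
    split; first exact: binary_collection0.
    exists (LieAdm_unit k); last exact: LieAdm_unit_gen.
    move=> u0; case/eqP: (LieAdm_parts_neq0 k).1.
    by rewrite /sym_part u0 act0 addr0.
  exact: (jacobiator_presentation (act_asym_part _) (LieAdm_relationE k)).
move=> E P g [E0 [mu mu0 mu_gen]] [R gR R_tight] [R' gR' R'_quad].
have [R0|Rn0] := pselect (forall n d x, R' n d x -> x = 0).
  left; have [f fbij _] := gR'; have [f' f'bij _] := free_presentation R0.
  by apply: op_iso_trans (ex_intro _ f' f'bij); apply: op_iso_sym; exists f.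
right.
have [n [d [x [Rx x0]]]] : exists n d x, R' n d x /\ x != 0.
  apply: contrapT => h; apply: Rn0 => n d x Rx.
  by apply/eqP; apply: contrapT => x0; apply: h; exists n, d, x; split=> //; apply/negP.
have [n2 d0] : n = 2%N /\ d = 0.
  have [//|h] := pselect (n = 2%N /\ d = 0); case/eqP: x0.
  apply: (quadratic_concentrated E0 R'_quad Rx).
  by have [n2|] := eqVneq n 2%N; [right=> d0; apply: h|move/eqP; left].
move: x Rx x0; rewrite n2 d0 => x Rx x0 {n n2 d d0}.
have [c xE] := tight_quadratic_jacobiator two_neq0 E0 mu_gen gR gR' R_tight R'_quad Rx.
have c0 : c != 0 by apply: contraNneq x0 => c0; rewrite xE c0 scale0r.
(* A nonzero multiple of the Jacobiator needs a nonzero antisymmetric part, which excludes a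
   symmetric operation. *)
have asym0 : asym_part mu <> 0.
  by move=> a0; move/eqP: x0; apply; rewrite xE a0 col_hom0 jacobiator0 scaler0.
have Rc : exists2 c, R' 2%N 0 (c *: jacobiator (free_gen E 1%N 0 (asym_part mu))) & c != 0.
  by exists c; rewrite -?xE.
have iso := tight_quadratic_iso two_neq0 E0 mu_gen gR gR' R_tight R'_quad.
(* The antisymmetric part alone spans the sign representation; together with a symmetric part it
   spans the regular one. *)
have [sym0|sym0] := pselect (sym_part mu = 0).
  left; rewrite /Lie_operad /Lie_relations (jacobiE two_neq0).
  apply: iso => //; try exact: binary_collection0.
  - exact: Lie_half_gen.
  - by rewrite oppr_eq0 oner_eq0.
  - by split=> // _; rewrite /sym_part act_Lie subrr.
  - rewrite (Lie_asym_part two_neq0); split=> // /eqP.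
    by rewrite -[X in X == _]/(1 : k) oner_eq0.
right; rewrite /LieAdm_operad /LieAdm_relations LieAdm_relationE.
apply: iso => //; try exact: binary_collection0.
- exact: LieAdm_unit_gen.
- by rewrite oner_eq0.
- by split=> // /eqP; rewrite (negPf (LieAdm_parts_neq0 k).1).
- by split=> // /eqP; rewrite (negPf (LieAdm_parts_neq0 k).2).
Qed.
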